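(* Let $n\ge 3$ and $2\le k\le n-1$, and let $M^n$ be a complete constant weighted mean curvature (CWMC) hypersurface properly immersed in the cylinder shrinking Ricci soliton $\mathbb{R}^{n+1-k}\times S^k_{\sqrt{2(k-1)}}(0)$. (a) If $M^n$ lies inside the closed product $\bar B^{n+1-k}_r(0)\times S^k_{\sqrt{2(k-1)}}(0)$ with $r=-|H_f|+\sqrt{H_f^2+2(n-k)}$, then $M^n=S^{n-k}_r(0)\times S^k_{\sqrt{2(k-1)}}(0)$ and $H_f\ge 0$, where the sign of $H_f$ is taken with respect to the outward unit normal $N=\bar\nabla f/|\bar\nabla f|$. (b) $M^n$ cannot lie outside the product $B^{n+1-k}_r(0)\times S^k_{\sqrt{2(k-1)}}(0)$ with $r=|H_f|+\sqrt{H_f^2+2(n+1-k)}$.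
   Context: The cylinder shrinking Ricci soliton is $\bar M^{n+1}=\mathbb{R}^{n+1-k}\times S^k_{\sqrt{2(k-1)}}(0)$ with the product metric $\bar g$ and potential function $f(x,y)=|x|^2/4$, where $x$ is the position vector in $\mathbb{R}^{n+1-k}$, $y$ the position vector in $\mathbb{R}^{k+1}$, and $S^k_\rho(0)\subset\mathbb{R}^{k+1}$ is the round sphere of radius $\rho$ centered at $0$. $B_r^{m}(0)$ and $\bar B_r^m(0)$ are the open and closed balls of radius $r$ centered at $0$ in $\mathbb{R}^m$. $M^n$ is an oriented immersed hypersurface with unit normal $N$; $\bar\nabla$ is the Levi-Civita connection of $\bar g$; the second fundamental form is $A(u,v)=\langle\bar\nabla_u v,N\rangle$, $\vec H=(\mathrm{tr}_{M^n}A)N$, $\vec H_f=\vec H+(\bar\nabla f)^\perp$, and the weighted mean curvature $H_f$ is defined by $\vec H_f=-H_fN$. $M^n$ is CWMC if $H_f$ is constant. Equality of the immersed hypersurface $M^n$ with a subset is understood as equality of its image. *)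

(* Defs.v *)
From HB Require Import structures.
From mathcomp Require Import all_boot all_order all_algebra.
From mathcomp Require Import all_classical all_reals all_analysis.

Set Implicit Arguments.
Unset Strict Implicit.
Unset Printing Implicit Defensive.

Import Order.TTheory GRing.Theory Num.Theory.
Import numFieldNormedType.Exports.

Local Open Scope classical_set_scope.
Local Open Scope ring_scope.

(* The norm of the library on row vectors is the sup norm; it is used only
   through its topology.  All metric notions below are Euclidean. *)
Definition edot (R : realType) (m : nat) (u v : 'rV[R]_m) : R :=
  \sum_i u 0 i * v 0 i.

Definition enorm (R : realType) (m : nat) (u : 'rV[R]_m) : R :=
  Num.sqrt (edot u u).

(* These three sets live in R^m, so [esphere m rho] has dimension m - 1. *)
Definition esphere (R : realType) (m : nat) (rho : R) : set 'rV[R]_m :=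
  [set x | enorm x = rho].

Definition eball (R : realType) (m : nat) (rho : R) : set 'rV[R]_m :=
  [set x | enorm x < rho].

Definition ecball (R : realType) (m : nat) (rho : R) : set 'rV[R]_m :=
  [set x | enorm x <= rho].

Definition rowprod (R : realType) (m1 m2 : nat)
    (A : set 'rV[R]_m1) (B : set 'rV[R]_m2) : set 'rV[R]_(m1 + m2) :=
  [set z | A (lsubmx z) /\ B (rsubmx z)].

(* For open [U] this is the class C^m: [f] is C^(m+1) iff it is
   differentiable and all its directional derivatives are C^m. *)
Fixpoint Ck_on (R : realType) (V W : normedModType R) (m : nat) (U : set V)
    (f : V -> W) : Prop :=
  if m is m'.+1 then
    (forall u, U u -> differentiable f u) /\
    (forall v, Ck_on m' U (fun u => 'D_v f u))
  else forall u, U u -> {for u, continuous f}.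

Definition smooth_on (R : realType) (V W : normedModType R) (U : set V)
    (f : V -> W) : Prop :=
  forall m : nat, Ck_on m U f.

(** Smooth manifolds *)

(* A chart is given by both directions of a homeomorphism between the open
   sets [chart_dom] of R^n and [chart_img] of the space; [chart_par] and
   [chart_coord] carry no information outside these sets. *)
Record chart (R : realType) (n : nat) (M : topologicalType) := Chart {
  chart_dom : set 'rV[R]_n;
  chart_img : set M;
  chart_par : 'rV[R]_n -> M;
  chart_coord : M -> 'rV[R]_n;
  chart_dom_open : open chart_dom;
  chart_img_open : open chart_img;
  chart_par_img : forall u, chart_dom u -> chart_img (chart_par u);
  chart_coord_dom : forall p, chart_img p -> chart_dom (chart_coord p);
  chart_parK : forall u, chart_dom u -> chart_coord (chart_par u) = u;
  chart_coordK : forall p, chart_img p -> chart_par (chart_coord p) = p;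
  chart_par_cont : forall u, chart_dom u -> {for u, continuous chart_par};
  chart_coord_cont : forall p, chart_img p -> {for p, continuous chart_coord}
}.

Definition smooth_atlas (R : realType) (n : nat) (M : topologicalType)
    (S : set (chart R n M)) : Prop :=
  (forall p : M, exists2 c, S c & chart_img c p) /\
  (forall c d, S c -> S d ->
     smooth_on (chart_dom c `&` chart_par c @^-1` chart_img d)
               (chart_coord d \o chart_par c)).

(* No connectedness is required. *)
Record manifold (R : realType) (n : nat) := Manifold {
  manifold_sort :> topologicalType;
  manifold_atlas : set (chart R n manifold_sort);
  manifold_hausdorff : hausdorff_space manifold_sort;
  manifold_second_countable : @second_countable manifold_sort;
  manifold_nonempty : [set: manifold_sort] !=set0;
  manifold_smooth : smooth_atlas manifold_atlas
}.

Definition smooth_map (R : realType) (n m : nat) (M : manifold R n)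
    (X : M -> 'rV[R]_m) : Prop :=
  forall c, manifold_atlas c -> smooth_on (chart_dom c) (X \o chart_par c).

Definition immersion (R : realType) (n m : nat) (M : manifold R n)
    (X : M -> 'rV[R]_m) : Prop :=
  smooth_map X /\
  forall c, manifold_atlas c -> forall u, chart_dom c u ->
    injective ('d (X \o chart_par c) u).

Definition C1_curve (R : realType) (n : nat) (M : manifold R n)
    (gamma : R -> M) : Prop :=
  continuous gamma /\
  forall c, manifold_atlas c ->
    Ck_on 1 (gamma @^-1` chart_img c) (chart_coord c \o gamma).

(* Length on [0, 1] for the metric on [M] induced by the immersion [X] into
   Euclidean space: the induced norm of gamma' is the Euclidean norm of
   (X o gamma)'. *)
Definition curve_length (R : realType) (n m : nat) (M : manifold R n)
    (X : M -> 'rV[R]_m) (gamma : R -> M) : \bar R :=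
  (\int[@lebesgue_measure R]_(t in `[0%R, 1%R])
     (enorm (derive1 (X \o gamma) t))%:E)%E.

(* Regularity of the curves (nonzero velocity) is not demanded, so the C^1
   curves give the same infimum as the piecewise C^1 ones: a reparametrisation
   stops at the corners and at both ends.  The value is +oo for points in
   different components. *)
Definition riem_dist (R : realType) (n m : nat) (M : manifold R n)
    (X : M -> 'rV[R]_m) (p q : M) : \bar R :=
  ereal_inf [set l | exists gamma : R -> M,
    [/\ C1_curve gamma, gamma 0 = p, gamma 1 = q & l = curve_length X gamma]].

Definition riem_complete (R : realType) (n m : nat) (M : manifold R n)
    (X : M -> 'rV[R]_m) : Prop :=
  forall s : nat -> M,
    (forall e : R, 0 < e -> exists K : nat, forall i j : nat,
       (K <= i)%N -> (K <= j)%N -> (riem_dist X (s i) (s j) < e%:E)%E) ->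
    exists q : M, s @ \oo --> q.

(** The cylinder, as a subset of R^(n+1-k) x R^(k+1) *)

(* Truncated subtraction: meaningful for k <= n + 1 only. *)
Notation ambient R n k := 'rV[R]_(n.+1 - k + k.+1).

Definition cyl_radius (R : realType) (k : nat) : R :=
  Num.sqrt (2 * (k - 1)%:R).

Definition cylinder (R : realType) (n k : nat) : set (ambient R n k) :=
  rowprod [set: 'rV[R]_(n.+1 - k)] (@esphere R k.+1 (cyl_radius R k)).

(* Orthogonal projection of R^(n+1-k) x R^(k+1) onto the tangent space of the
   cylinder at [z] = (x, y), that is onto the orthogonal of (0, y). *)
Definition cyl_proj (R : realType) (n k : nat) (z v : ambient R n k) :
    ambient R n k :=
  v - (edot (rsubmx v) (rsubmx z) / edot (rsubmx z) (rsubmx z))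
        *: row_mx 0 (rsubmx z).

(* Gradient on the cylinder of the restriction of [g]. *)
Definition cyl_grad (R : realType) (n k : nat) (g : ambient R n k -> R)
    (z : ambient R n k) : ambient R n k :=
  cyl_proj z (\row_i 'D_(delta_mx 0 i) g z).

Definition potential (R : realType) (n k : nat) (z : ambient R n k) : R :=
  enorm (lsubmx z) ^+ 2 / 4.

Definition outward_normal (R : realType) (n k : nat) (z : ambient R n k) :
    ambient R n k :=
  (enorm (cyl_grad (@potential R n k) z))^-1
    *: cyl_grad (@potential R n k) z.

(** Hypersurfaces of the cylinder *)

Definition immersed_hypersurface (R : realType) (n k : nat)
    (M : manifold R n) (X : M -> ambient R n k) : Prop :=
  (forall p, cylinder (X p)) /\ immersion X.

Definition proper_in_cylinder (R : realType) (n k : nat)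
    (M : manifold R n) (X : M -> ambient R n k) : Prop :=
  forall K : set (ambient R n k),
    K `<=` @cylinder R n k -> compact K -> compact (X @^-1` K).

(* The cylinder being orientable, an orientation of M amounts to such an N. *)
Definition unit_normal (R : realType) (n k : nat) (M : manifold R n)
    (X N : M -> ambient R n k) : Prop :=
  [/\ smooth_map N,
      forall p, enorm (N p) = 1,
      forall p, cyl_proj (X p) (N p) = N p &
      forall c, manifold_atlas c -> forall u, chart_dom c u ->
        forall v : 'rV[R]_n,
          edot (N (chart_par c u)) ('D_v (X \o chart_par c) u) = 0].

Definition first_form (R : realType) (n m : nat) (F : 'rV[R]_n -> 'rV[R]_m)
    (u : 'rV[R]_n) : 'M[R]_n :=
  \matrix_(i, j) edot ('D_(delta_mx 0 i) F u) ('D_(delta_mx 0 j) F u).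

(* Levi-Civita covariant derivative, in the cylinder, of the coordinate field
   d_j F along d_i F: tangential part of the derivative in Euclidean space. *)
Definition cyl_nabla (R : realType) (n k : nat)
    (F : 'rV[R]_n -> ambient R n k) (i j : 'I_n) (u : 'rV[R]_n) :
    ambient R n k :=
  cyl_proj (F u) ('D_(delta_mx 0 i) (fun w => 'D_(delta_mx 0 j) F w) u).

Definition second_form (R : realType) (n k : nat)
    (F : 'rV[R]_n -> ambient R n k) (nu : ambient R n k) (u : 'rV[R]_n) :
    'M[R]_n :=
  \matrix_(i, j) edot (cyl_nabla F i j u) nu.

Definition mean_curvature_vector (R : realType) (n k : nat)
    (F : 'rV[R]_n -> ambient R n k) (nu : ambient R n k) (u : 'rV[R]_n) :
    ambient R n k :=
  \tr (invmx (first_form F u) *m second_form F nu u) *: nu.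

Definition weighted_mean_curvature_vector (R : realType) (n k : nat)
    (F : 'rV[R]_n -> ambient R n k) (nu : ambient R n k) (u : 'rV[R]_n) :
    ambient R n k :=
  mean_curvature_vector F nu u
  + edot (cyl_grad (@potential R n k) (F u)) nu *: nu.

(* The weighted mean curvature with respect to [N] is the constant [h]. *)
Definition cwmc (R : realType) (n k : nat) (M : manifold R n)
    (X N : M -> ambient R n k) (h : R) : Prop :=
  forall c, manifold_atlas c -> forall u, chart_dom c u ->
    weighted_mean_curvature_vector (X \o chart_par c) (N (chart_par c u)) u
      = - h *: N (chart_par c u).

(* Main.v *)
Require Import Defs.
From mathcomp Require Import all_boot all_order all_algebra.
From mathcomp Require Import all_classical all_reals all_analysis.
From mathcomp Require Import ring lra.
Import Order.TTheory GRing.Theory Num.Theory.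
Import numFieldNormedType.Exports.
Local Open Scope classical_set_scope.
Local Open Scope ring_scope.

Set Implicit Arguments.
Unset Strict Implicit.
Unset Printing Implicit Defensive.

(** Write [x] for the first component of [X], [phi = |x|^2] for the squared
    distance to the axis, [N_x] for the first component of the unit normal and
    [p = <x, N_x>]. The tangent space is the orthogonal complement of [N] in the
    tangent space of the cylinder, so the horizontal part of the metric has trace
    [n + 1 - k - |N_x|^2] on it; the weighted mean curvature equation says that
    the mean curvature is [- h - p / 2]. Together they give
<<
      Laplacian phi = 2 (n + 1 - k - |N_x|^2) - 2 h p - p^2
>>
    ([patch_laplacian]), and both parts are maximum principles for [phi].

    Outside: properness makes [phi] attain its minimum. There [x] is normal to
    the hypersurface, so [|N_x| = 1] and [p^2 = |x|^2], and the choice of [r]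
    makes the Laplacian negative, against minimality ([patch_no_local_min]).

    Inside: properness makes the hypersurface compact. As [p^2 <= |x|^2 |N_x|^2]
    and [|x| <= r], the Laplacian is nonnegative, and it vanishes only if
    [|x| = r], [|N_x| = 1], [p^2 = r^2] and [h p = |h| r] ([patch_equality]).
    By E. Hopf's strong maximum principle ([strong_maximum_principle]) the set
    [phi = r^2] is open; its complement is then compact, and a maximum of [phi]
    on it would again have the value [r^2]. Hence [phi = r^2] everywhere
    ([inside_constant]), the outward normal is [p / r] times [N], and its weighted
    mean curvature is [h p / r = |h|].

    The image is the whole product because, for [z0] in the product, a point where
    [<X, z0>] is maximal must be mapped to [z0] ([patch_height_max]): this needs
    only the second derivative test, and no connectedness.

    The Laplacian enters as a sum of squares. The coordinates [c l] of the
    tangential parts of the standard basis vectors of the ambient space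
    ([frame]) satisfy [sum_l c_l (x) c_l = g^-1], so
    [sum_l D_(c l) D_(c l) + drift] has the principal part of the Laplacian, and
    at an extremum its sign follows from second derivatives along lines. The
    drift absorbs the Christoffel symbols. *)

(** * Euclidean inner product *)

Section EuclideanProduct.
Variables (R : realType) (m : nat).
Implicit Types u v w : 'rV[R]_m.

Lemma edotC u v : edot u v = edot v u.
Proof. by apply: eq_bigr => i _; rewrite mulrC. Qed.

Lemma edotDl u v w : edot (u + v) w = edot u w + edot v w.
Proof. by rewrite -big_split; apply: eq_bigr => i _; rewrite mxE mulrDl. Qed.

Lemma edotZl (a : R) u v : edot (a *: u) v = a * edot u v.
Proof. by rewrite mulr_sumr; apply: eq_bigr => i _; rewrite mxE mulrA. Qed.

Lemma edotDr u v w : edot w (u + v) = edot w u + edot w v.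
Proof. by rewrite edotC edotDl !(edotC w). Qed.

Lemma edotZr (a : R) u v : edot v (a *: u) = a * edot v u.
Proof. by rewrite edotC edotZl edotC. Qed.

Lemma edotNl u v : edot (- u) v = - edot u v.
Proof. by rewrite -scaleN1r edotZl mulN1r. Qed.

Lemma edotNr u v : edot u (- v) = - edot u v.
Proof. by rewrite edotC edotNl edotC. Qed.

Lemma edot0l v : edot 0 v = 0.
Proof. by rewrite -(scale0r v) edotZl mul0r. Qed.

Lemma edot0r v : edot v 0 = 0.
Proof. by rewrite edotC edot0l. Qed.

Lemma edot_suml I (s : seq I) (f : I -> 'rV[R]_m) v :
  edot (\sum_(i <- s) f i) v = \sum_(i <- s) edot (f i) v.
Proof.
by elim/big_ind2: _ => [|w a w' b <- <-|//]; rewrite ?edot0l ?edotDl.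
Qed.

Lemma edot_ge0 u : 0 <= edot u u.
Proof. by apply: sumr_ge0 => i _; rewrite -expr2 sqr_ge0. Qed.

Lemma edot_eq0 u : (edot u u == 0) = (u == 0).
Proof.
apply/idP/eqP => [|->]; last by rewrite edot0l.
rewrite psumr_eq0 => [/allP u0|i _]; last by rewrite -expr2 sqr_ge0.
apply/rowP => i; rewrite mxE; apply/eqP.
by rewrite -sqrf_eq0 expr2; exact: u0 (mem_index_enum i).
Qed.

Lemma edot_gt0 u : (0 < edot u u) = (u != 0).
Proof. by rewrite lt_def edot_ge0 andbT edot_eq0. Qed.

Lemma enorm_sqr u : enorm u ^+ 2 = edot u u.
Proof. by rewrite sqr_sqrtr ?edot_ge0. Qed.

Lemma edot_mulmx u v : edot u v = (u *m v^T) 0 0.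
Proof. by rewrite mxE; apply: eq_bigr => i _; rewrite mxE. Qed.

Lemma edot_cauchy_schwarz u v : edot u v ^+ 2 <= edot u u * edot v v.
Proof.
have [->|v0] := eqVneq v 0; first by rewrite !edot0r expr0n mulr0.
have vv : 0 < edot v v by rewrite edot_gt0.
rewrite -subr_ge0 -(pmulr_rge0 _ vv).
have := edot_ge0 (edot v v *: u - edot u v *: v).
rewrite !(edotDl, edotDr, edotNl, edotNr, edotZl, edotZr) (edotC v u).
by move=> H; apply: le_trans H _; rewrite le_eqVlt; apply/orP; left; apply/eqP; ring.
Qed.

(** The orthogonal complement of [u] has dimension at least [m - 1]. *)
Lemma exists_orthogonal u : (2 <= m)%N -> exists2 v, v != 0 & edot u v = 0.
Proof.
move=> m2; have : kermx u^T != 0.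
  rewrite -mxrank_eq0 mxrank_ker -lt0n subn_gt0.
  exact: leq_ltn_trans (rank_leq_col _) m2.
move=> /rowV0Pn[v /sub_kermxP vu v0]; exists v => //.
by rewrite edotC edot_mulmx vu mxE.
Qed.

End EuclideanProduct.

Lemma edot_lrsubmx (R : realType) m1 m2 (u v : 'rV[R]_(m1 + m2)) :
  edot u v = edot (lsubmx u) (lsubmx v) + edot (rsubmx u) (rsubmx v).
Proof.
rewrite /edot big_split_ord /=.
by congr (_ + _); apply: eq_bigr => i _; rewrite !mxE.
Qed.

Lemma norm_le_of_sqr (R : realType) (a b : R) :
  0 <= b -> a ^+ 2 <= b ^+ 2 -> `|a| <= b.
Proof. by move=> b0 ab; rewrite -ler_sqr ?nnegrE //= real_normK ?num_real. Qed.

Lemma le_norm_of_sqr (R : realType) (a b : R) :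
  0 <= b -> b ^+ 2 <= a ^+ 2 -> b <= `|a|.
Proof. by move=> b0 ab; rewrite -ler_sqr ?nnegrE //= real_normK ?num_real. Qed.

(** * Differential calculus *)

Section DirectionalDerivatives.
Variables (R : realType) (V : normedModType R).

Lemma is_derive_edot m (f g : V -> 'rV[R]_m) x v df dg :
  is_derive x v f df -> is_derive x v g dg ->
  is_derive x v (fun y => edot (f y) (g y)) (edot df (g x) + edot (f x) dg).
Proof.
move=> [df1 df2] [dg1 dg2].
have coordD (p : V -> 'rV[R]_m) i : derivable p x v ->
    is_derive x v (fun y => p y 0 i) ('D_v p x 0 i).
  move=> dp; apply: DeriveDef; first by move/derivable_mxP: dp; apply.
  by rewrite [in RHS](derive_mx dp) mxE.
have -> : (fun y => edot (f y) (g y)) =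
    \sum_i ((fun y => f y 0 i) * (fun y => g y 0 i)).
  by apply/funext => y; rewrite fct_sumE.
apply: is_derive_eq.
  apply: is_derive_sum => i; apply: is_deriveM; exact: coordD.
rewrite /edot -big_split /=; apply: eq_bigr => i _; rewrite df2 dg2 /= addrC.
by rewrite /GRing.scale /= [g x 0 i * _]mulrC.
Qed.

Lemma is_derive_val_eq (W : normedModType R) (f : V -> W) x v (df df' : W) :
  is_derive x v f df -> df = df' -> is_derive x v f df'.
Proof. by move=> d <-. Qed.

Lemma is_derive_combination (f g : V -> R) (a : R) x v df dg :
  is_derive x v f df -> is_derive x v g dg ->
  is_derive x v (fun y => f y + a * g y) (df + a * dg).
Proof. by move=> df' dg'; exact: is_deriveD df' (is_deriveZ a dg'). Qed.

Lemma is_derive_mul (f g : V -> R) x v (df dg : R) :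
  is_derive x v f df -> is_derive x v g dg ->
  is_derive x v (fun y => f y * g y) (df * g x + f x * dg).
Proof.
move=> df' dg'; apply: is_derive_val_eq (is_deriveM df' dg') _.
by rewrite addrC [df * _]mulrC.
Qed.

Lemma is_derive_line (f : V -> R) (x v : V) (s l : R) :
  is_derive (s *: v + x) v f l -> is_derive s (1 : R) (fun t => f (t *: v + x)) l.
Proof.
have E : (fun h : R => h^-1 *:
      (((fun t => f (t *: v + x)) \o shift s) (h *: (1 : R)) - f (s *: v + x))) =
    (fun h => h^-1 *: ((f \o shift (s *: v + x)) (h *: v) - f (s *: v + x))).
  by apply/funext => h /=; rewrite [h *: 1]mulr1 scalerDl addrA.
by move=> [d1 d2]; apply: DeriveDef; rewrite /derivable /derive E.
Qed.

Lemma is_derive_line_inv (f : V -> R) (x v : V) (l : R) :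
  is_derive x v f l -> is_derive (0 : R) (1 : R) (fun t => f (t *: v + x)) l.
Proof. by move=> d; apply: is_derive_line; rewrite scale0r add0r. Qed.

Lemma near_line (x v : V) (P : set V) :
  (\forall y \near x, P y) -> \forall t \near (0 : R), P (t *: v + x).
Proof.
move=> nP; have : (fun t : R => t *: v + x) t @[t --> (0:R)] --> (0 : R) *: v + x.
  by apply: cvgD; [apply: cvgZr_tmp; exact: cvg_id|exact: cvg_cst].
by rewrite scale0r add0r; apply.
Qed.

(** The restriction of [f] to the line through [x] has a local maximum; if its
    second derivative were positive, its first derivative would be positive
    just after 0, and the mean value theorem would give a larger value. *)
Lemma second_derivative_test (f : V -> R) (x v : V) :
  (\forall y \near x, derivable f y v) -> derivable ('D_v f) x v ->
  (\forall y \near x, f y <= f x) ->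
  'D_v f x = 0 /\ 'D_v ('D_v f) x <= 0.
Proof.
move=> /(near_line v) df ddf /(near_line v) fmax.
have : \forall t \near (0 : R), derivable f (t *: v + x) v /\ f (t *: v + x) <= f x.
  exact: filterI df fmax.
move=> /nbhs_ballP[e /= e0 he].
pose g (t : R) : R := f (t *: v + x); pose g' (t : R) : R := 'D_v f (t *: v + x).
have hg (t : R) : `|t| < e -> is_derive t (1 : R) g (g' t).
  move=> te; apply: is_derive_line; apply/derivableP; apply: (he t _).1.
  by rewrite /ball /= sub0r normrN.
have hmax (t : R) : `|t| < e -> g t <= g 0.
  move=> te; rewrite {2}/g scale0r add0r; apply: (he t _).2.
  by rewrite /ball /= sub0r normrN.
have g'0 : g' 0 = 0.
  have [||||_] := @derive1_at_max R g (- e) e 0.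
  - by rewrite ge0_cp // ltW.
  - by move=> t; rewrite in_itv /= -ltr_norml => /hg [].
  - by rewrite in_itv /= oppr_lt0 e0.
  - by move=> t; rewrite in_itv /= -ltr_norml => /hmax.
  by have [_ ->] := hg 0 ltac:(by rewrite normr0).
split; first by rewrite -g'0 /g' scale0r add0r.
have /derivableP/is_derive_line_inv[dg' <-] := ddf.
rewrite leNgt; apply/negP => pos.
have : \forall t \near 0^'+, 0 < g' t.
  move/cvg_ex : dg' => [l hl].
  have E : 'D_1 g' 0 = l by apply/cvg_lim.
  rewrite -/g' E in pos; move/cvgrPdist_lt : hl => /(_ _ pos).
  move=> [d /= d0 hd]; exists d => //= t; rewrite /ball_ /= sub0r normrN => td t0.
  have := hd t; rewrite /ball_ /= sub0r normrN gt_eqF // => /(_ td isT).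
  rewrite -/(g' _) [t *: 1]mulr1 addr0 -/(g' 0) g'0 subr0.
  rewrite ltr_norml => /andP[_]; rewrite gtrBl /GRing.scale /=.
  by rewrite pmulr_rgt0 // invr_gt0.
move=> [d /= d0 hd].
have [t [t0 td te]] : exists t, [/\ 0 < t, t < d & t < e].
  have m0 : 0 < Num.min d e by rewrite lt_min d0.
  have [md me] : Num.min d e <= d /\ Num.min d e <= e by rewrite !ge_min !lexx orbT.
  by exists (Num.min d e / 2); split; lra.
have [||s] := @MVT R g g' 0 t t0.
- move=> s; rewrite in_itv /= => /andP[s0 st]; apply: hg.
  by rewrite gtr0_norm // (lt_trans st).
- apply: derivable_within_continuous => s; rewrite in_itv /= => /andP[s0 st].
  by have [] // := hg s; rewrite ger0_norm // (le_lt_trans st).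
rewrite in_itv /= => /andP[s0 st] gt.
have : 0 < g t - g 0.
  rewrite gt subr0 mulr_gt0 // hd //= /ball_ /= sub0r normrN gtr0_norm //.
  exact: lt_trans td.
by rewrite subr_gt0 ltNge hmax // gtr0_norm.
Qed.
End DirectionalDerivatives.

(** * Continuity in coordinates *)

Section Continuity.
Variables (R : realType).

Section ContinuousAt.
Variables (T : topologicalType) (u : T).

Lemma cont_cst (x : R) : {for u, continuous (fun _ : T => x)}.
Proof. exact: cvg_cst. Qed.

Lemma cont_add (f g : T -> R) :
  {for u, continuous f} -> {for u, continuous g} ->
  {for u, continuous (fun y => f y + g y)}.
Proof. by move=> cf cg; apply: cvgD. Qed.

Lemma cont_mul (f g : T -> R) :
  {for u, continuous f} -> {for u, continuous g} ->
  {for u, continuous (fun y => f y * g y)}.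
Proof. by move=> cf cg; apply: cvgM. Qed.

Lemma cont_opp (f : T -> R) :
  {for u, continuous f} -> {for u, continuous (fun y => - f y)}.
Proof. by move=> cf; apply: cvgN. Qed.

Lemma cont_sum I (r : seq I) (P : pred I) (f : I -> T -> R) :
  (forall i, {for u, continuous (f i)}) ->
  {for u, continuous (fun y => \sum_(i <- r | P i) f i y)}.
Proof. by move=> cf; apply: cvg_big; [exact: add_continuous|move=> i _; exact: cf]. Qed.

Lemma cont_prod I (r : seq I) (P : pred I) (f : I -> T -> R) :
  (forall i, {for u, continuous (f i)}) ->
  {for u, continuous (fun y => \prod_(i <- r | P i) f i y)}.
Proof. by move=> cf; apply: cvg_big; [exact: mul_continuous|move=> i _; exact: cf]. Qed.

Lemma cont_inv (f : T -> R) : f u != 0 ->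
  {for u, continuous f} -> {for u, continuous (fun y => (f y)^-1)}.
Proof. by move=> fu cf; apply: cvgV. Qed.

Lemma cont_mx m1 m2 (f : T -> 'M[R]_(m1, m2)) :
  (forall i j, {for u, continuous (fun y => f y i j)}) -> {for u, continuous f}.
Proof.
move=> cf A [B nB BA]; rewrite near_simpl.
have : \forall y \near u, forall i j, B i j (f y i j).
  by apply: filter_forall => i; apply: filter_forall => j; exact: cf.
by apply: filterS => y By; exact: BA.
Qed.

Lemma cont_near_eq (W : topologicalType) (f g : T -> W) :
  (\forall y \near u, f y = g y) ->
  {for u, continuous f} -> {for u, continuous g}.
Proof.
move=> fg cf; suff : g @ u --> f u by rewrite (nbhs_singleton fg).
by apply: cvg_trans cf; apply: near_eq_cvg; apply: filterS fg.
Qed.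

Lemma cont_det m (A : T -> 'M[R]_m) :
  (forall i j, {for u, continuous (fun y => A y i j)}) ->
  {for u, continuous (fun y => \det (A y))}.
Proof.
move=> cA; apply: cont_sum => s; apply: cont_mul; first exact: cont_cst.
by apply: cont_prod => i; exact: cA.
Qed.

(** By Cramer's rule. *)
Lemma cont_invmx m (A : T -> 'M[R]_m) i j :
  (\forall y \near u, A y \in unitmx) ->
  (forall i j, {for u, continuous (fun y => A y i j)}) ->
  {for u, continuous (fun y => invmx (A y) i j)}.
Proof.
move=> uA cA.
apply: (@cont_near_eq _ (fun y => (\det (A y))^-1 * cofactor (A y) j i)).
  by apply: filterS uA => y Ay; rewrite /invmx Ay !mxE.
apply: cont_mul.
  apply: cont_inv; last exact: cont_det.
  by have := nbhs_singleton uA; rewrite unitmxE unitfE.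
apply: cont_mul; first exact: cont_cst.
apply: cont_det => i' j'.
by under [X in {for _, continuous X}]eq_fun do rewrite !mxE; exact: cA.
Qed.

Lemma cont_coord m1 m2 (f : T -> 'M[R]_(m1, m2)) i j :
  {for u, continuous f} -> {for u, continuous (fun y => f y i j)}.
Proof. by move=> cf; exact: cvg_comp cf (@coord_continuous _ _ _ i j (f u)). Qed.

Lemma cont_edot m (f g : T -> 'rV[R]_m) :
  {for u, continuous f} -> {for u, continuous g} ->
  {for u, continuous (fun y => edot (f y) (g y))}.
Proof. by move=> cf cg; apply: cont_sum => i; apply: cont_mul; exact: cont_coord. Qed.

End ContinuousAt.

Lemma continuous_subr (V : normedModType R) (q u : V) :
  {for u, continuous (fun x => x - q)}.
Proof. by apply: cvgB; [exact: cvg_id|exact: cvg_cst]. Qed.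

Lemma continuous_dist (V : normedModType R) (q u : V) :
  {for u, continuous (fun x => `|x - q|)}.
Proof. by apply: cvg_norm; exact: continuous_subr. Qed.

Lemma continuous_sqr_dist m (q u : 'rV[R]_m) :
  {for u, continuous (fun x : 'rV[R]_m => edot (x - q) (x - q))}.
Proof.
by apply: cont_edot; exact: continuous_subr.
Qed.

Lemma sqr_norm_le_edot m (u : 'rV[R]_m) : `|u| ^+ 2 <= edot u u.
Proof.
rewrite /Num.Def.normr /= /Num.Def.normr /=.
have [->|u0] := eqVneq (mx_norm u) 0; first by rewrite expr0n /= edot_ge0.
have [[i j] ->] := mx_norm_neq0 u0.
rewrite /= ord1 real_normK ?num_real // /edot (bigD1 j) //= expr2 lerDl.
by apply: sumr_ge0 => l _; rewrite -expr2 sqr_ge0.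
Qed.

Lemma near_lt_continuous (T : topologicalType) (f : T -> R) (u : T) (d : R) :
  {for u, continuous f} -> f u < d -> \forall y \near u, f y < d.
Proof.
move=> cf fd; have : nbhs (f u) [set x | x < d].
  by apply: open_nbhs_nbhs; split; [exact: open_lt|].
exact: cf.
Qed.

Lemma near_gt_continuous (T : topologicalType) (f : T -> R) (u : T) (d : R) :
  {for u, continuous f} -> d < f u -> \forall y \near u, d < f y.
Proof.
move=> cf fd; have : nbhs (f u) [set x | d < x].
  by apply: open_nbhs_nbhs; split; [exact: open_gt|].
exact: cf.
Qed.

(** [f] is only controlled on [U], so this is not the closedness of a preimage
    under a continuous function. *)
Lemma closed_fiber (T : topologicalType) (U K : set T) (f : T -> R) (Z : set R) :
  closed K -> K `<=` U -> (forall u, U u -> {for u, continuous f}) -> closed Z ->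
  closed (K `&` f @^-1` Z).
Proof.
move=> clK KU cf clZ; rewrite -[X in closed X]setCK closedC openE => u /= nKZ.
have [Ku|nKu] := pselect (K u); last first.
  have : nbhs u (~` K) by apply: open_nbhs_nbhs; split => //; exact: closed_openC.
  by apply: filterS => w nK [].
have fZ : nbhs (f u) (~` Z).
  by apply: open_nbhs_nbhs; split; [exact: closed_openC|move=> fZ; apply: nKZ].
have : nbhs u (f @^-1` (~` Z)) := cf u (KU u Ku) _ fZ.
by apply: filterS => w nZ [_].
Qed.

Lemma compact_euclidean_ball m (p : 'rV[R]_m) (d : R) :
  compact [set u | edot (u - p) (u - p) <= d].
Proof.
apply: bounded_closed_compact.
  exists (`|p| + (d + 1)); split; first exact: num_real.
  move=> M hM u /= ud; apply: le_trans (ltW hM).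
  have -> : u = p + (u - p) by rewrite addrC subrK.
  rewrite (le_trans (ler_normD _ _)) // lerD2l.
  have := le_trans (sqr_norm_le_edot _) ud; have := normr_ge0 (u - p); nra.
have := @closed_comp _ _ (fun u : 'rV[R]_m => edot (u - p) (u - p))
  [set x | x <= d].
by apply=> [u _|]; [exact: continuous_sqr_dist|exact: closed_le].
Qed.

Lemma near_sqr_dist m (p : 'rV[R]_m) (d : R) :
  0 < d -> \forall u \near p, edot (u - p) (u - p) < d.
Proof.
move=> d0; apply: (near_lt_continuous (@continuous_sqr_dist _ p p)).
by rewrite subrr edot0l.
Qed.

End Continuity.

(** * Maximum principles for sums of squares of directional derivatives *)

Section SumOfSquares.
Variables (R : realType) (n N : nat).

(** With [c] the rows of a matrix field whose Gram matrix is the inverse of the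
    metric, this is a second order operator with the principal part of the
    Laplacian; the sum of squares makes its ellipticity visible without
    diagonalising anything. *)
Definition sum_squares (c : 'I_N -> 'rV[R]_n) (b : 'rV[R]_n)
    (f : 'rV[R]_n -> R) (u : 'rV[R]_n) : R :=
  \sum_l 'D_(c l) ('D_(c l) f) u + 'D_b f u.

Definition twice_derivable_on (U : set 'rV[R]_n) (f : 'rV[R]_n -> R) : Prop :=
  forall u, U u -> forall v,
    derivable f u v /\ forall w, derivable ('D_v f) u w.

Lemma twice_derivableP (U : set 'rV[R]_n) (f : 'rV[R]_n -> R) u v w :
  twice_derivable_on U f -> U u ->
  is_derive u v f ('D_v f u) /\ is_derive u w ('D_v f) ('D_w ('D_v f) u).
Proof.
move=> Df Uu; have [h1 h2] := Df u Uu v.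
by split; [exact: DeriveDef h1 erefl|exact: DeriveDef (h2 w) erefl].
Qed.

Section Combination.
Variables (U : set 'rV[R]_n) (f g : 'rV[R]_n -> R) (a : R).
Hypotheses (oU : open U).
Hypotheses (Df : twice_derivable_on U f) (Dg : twice_derivable_on U g).

Let near_derive u v : U u ->
  \forall y \near u, 'D_v f y + a * 'D_v g y = 'D_v (fun y => f y + a * g y) y.
Proof.
move=> Uu; have := open_nbhs_nbhs (conj oU Uu); apply: filterS => y Uy.
have [fy _] := twice_derivableP v v Df Uy.
have [gy _] := twice_derivableP v v Dg Uy.
by have [_ ->] := is_derive_combination a fy gy.
Qed.

Let is_derive2 u v w : U u ->
  is_derive u w ('D_v (fun y => f y + a * g y))
    ('D_w ('D_v f) u + a * 'D_w ('D_v g) u).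
Proof.
move=> Uu; apply: near_eq_is_derive (near_derive v Uu) _.
have [_ fu] := twice_derivableP v w Df Uu.
have [_ gu] := twice_derivableP v w Dg Uu.
exact: is_derive_combination.
Qed.

Lemma twice_derivable_combination :
  twice_derivable_on U (fun y => f y + a * g y).
Proof.
move=> u Uu v; split; last by move=> w; have [] := is_derive2 v w Uu.
have [fu _] := twice_derivableP v v Df Uu.
have [gu _] := twice_derivableP v v Dg Uu.
by have [] := is_derive_combination a fu gu.
Qed.

Lemma sum_squares_combination c b u : U u ->
  sum_squares c b (fun y => f y + a * g y) u =
    sum_squares c b f u + a * sum_squares c b g u.
Proof.
move=> Uu; have E1 := nbhs_singleton (near_derive b Uu).
have E2 l : 'D_(c l) ('D_(c l) (fun y => f y + a * g y)) u =
    'D_(c l) ('D_(c l) f) u + a * 'D_(c l) ('D_(c l) g) u.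
  by have [_] := is_derive2 (c l) (c l) Uu.
have -> : sum_squares c b (fun y => f y + a * g y) u =
    \sum_l ('D_(c l) ('D_(c l) f) u + a * 'D_(c l) ('D_(c l) g) u) +
    ('D_b f u + a * 'D_b g u).
  by congr (_ + _); [exact: eq_bigr|rewrite E1].
by rewrite big_split /= -mulr_sumr mulrDr addrACA.
Qed.

End Combination.

Lemma derive_local_max (U : set 'rV[R]_n) (f : 'rV[R]_n -> R) u v :
  open U -> U u -> twice_derivable_on U f -> (\forall y \near u, f y <= f u) ->
  'D_v f u = 0 /\ 'D_v ('D_v f) u <= 0.
Proof.
move=> oU Uu Df fmax; apply: second_derivative_test => //.
  have := open_nbhs_nbhs (conj oU Uu).
  by apply: filterS => w Uw; have [] := Df w Uw v.
by have [_] := Df u Uu v.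
Qed.

Lemma sum_squares_local_max (U : set 'rV[R]_n) c b (f : 'rV[R]_n -> R) u :
  open U -> U u -> twice_derivable_on U f ->
  (\forall y \near u, f y <= f u) -> sum_squares c b f u <= 0.
Proof.
move=> oU Uu Df fmax.
rewrite /sum_squares (derive_local_max b oU Uu Df fmax).1 addr0.
by apply: sumr_le0 => l _; exact: (derive_local_max _ oU Uu Df fmax).2.
Qed.

Lemma sum_squares_local_min (U : set 'rV[R]_n) c b (f : 'rV[R]_n -> R) u :
  open U -> U u -> twice_derivable_on U f -> (\forall y \near u, f u <= f y) ->
  (forall v, 'D_v f u = 0) /\ 0 <= sum_squares c b f u.
Proof.
move=> oU Uu Df fmin.
(* [f - 2 * f] is [- f] in the form of a combination. *)
have Dg := twice_derivable_combination (- 2) oU Df Df.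
have gmax : \forall y \near u, f y + - 2 * f y <= f u + - 2 * f u.
  by apply: filterS fmin => y; lra.
split=> [v|]; last first.
  have := sum_squares_local_max c b oU Uu Dg gmax.
  by rewrite (sum_squares_combination _ oU Df Df _ _ Uu); lra.
have [fu _] := twice_derivableP v v Df Uu.
have [+ _] := derive_local_max v oU Uu Dg gmax.
by have [_ ->] := is_derive_combination (- 2) fu fu; lra.
Qed.

End SumOfSquares.

Section Barrier.
Variables (R : realType) (n N : nat) (q : 'rV[R]_n) (s a : R).

(** Positive exactly on the Euclidean ball of squared radius [s] about [q], as
    long as [1 + a * height] stays positive.  The quadratic term is the
    polynomial substitute for the usual exponential barrier: it adds
    [8 * a * edot (u - q) (c l) ^+ 2] to the second derivatives and nothing else
    on the sphere. *)
Definition height (u : 'rV[R]_n) : R := s - edot (u - q) (u - q).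

Definition barrier (u : 'rV[R]_n) : R := height u + a * (height u * height u).

Lemma is_derive_sub_cst (u v : 'rV[R]_n) :
  is_derive u v (fun y : 'rV[R]_n => y - q) v.
Proof.
have := is_deriveB (is_derive_id u v) (is_derive_cst q u v).
by rewrite subr0.
Qed.

Lemma is_derive_height (u v : 'rV[R]_n) :
  is_derive u v height (- 2 * edot (u - q) v).
Proof.
have d := is_derive_edot (is_derive_sub_cst u v) (is_derive_sub_cst u v).
apply: is_derive_val_eq (is_deriveB (is_derive_cst s u v) d) _.
by rewrite (edotC v); ring.
Qed.

Lemma is_derive_barrier (u v : 'rV[R]_n) :
  is_derive u v barrier ((1 + 2 * a * height u) * (- 2 * edot (u - q) v)).
Proof.
have d := is_derive_height u v.
apply: is_derive_val_eq (is_derive_combination a d (is_derive_mul d d)) _.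
ring.
Qed.

Lemma is_derive2_barrier (u v w : 'rV[R]_n) :
  is_derive u w ('D_v barrier)
    ((1 + 2 * a * height u) * (- 2 * edot w v) +
     8 * a * (edot (u - q) v * edot (u - q) w)).
Proof.
have -> : 'D_v barrier =
    fun y => (1 + 2 * a * height y) * (- 2 * edot (y - q) v).
  by apply/funext => y; have [_] := is_derive_barrier y v.
have d1 : is_derive u w (fun y => 1 + 2 * a * height y)
    (0 + 2 * a * (- 2 * edot (u - q) w)).
  exact: (is_derive_combination (2 * a) (is_derive_cst (1 : R) u w)
    (is_derive_height u w)).
have d2 : is_derive u w (fun y : 'rV[R]_n => 0 + (- 2) * edot (y - q) v)
    (0 + (- 2) * (edot w v + edot (u - q) 0)).
  apply: (is_derive_combination (- 2) (is_derive_cst (0 : R) u w)).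
  exact: is_derive_edot (is_derive_sub_cst u w) (is_derive_cst v u w).
have := is_derive_mul d1 d2; rewrite edot0r.
have -> : (fun y : 'rV[R]_n => (1 + 2 * a * height y) * (0 + (- 2) * edot (y - q) v)) =
    fun y => (1 + 2 * a * height y) * (- 2 * edot (y - q) v).
  by apply/funext => y; rewrite add0r.
by move=> d; apply: is_derive_val_eq d _; ring.
Qed.

Lemma twice_derivable_barrier (U : set 'rV[R]_n) : twice_derivable_on U barrier.
Proof.
by move=> u _ v; split=> [|w]; [have [] := is_derive_barrier u v|
  have [] := is_derive2_barrier u v w].
Qed.

Lemma sum_squares_barrier (c : 'I_N -> 'rV[R]_n) b u :
  sum_squares c b barrier u =
    (1 + 2 * a * height u) *
      (- 2 * (\sum_l edot (c l) (c l) + edot (u - q) b)) +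
    8 * a * \sum_l edot (u - q) (c l) ^+ 2.
Proof.
have E1 : 'D_b barrier u = (1 + 2 * a * height u) * (- 2 * edot (u - q) b).
  by have [_] := is_derive_barrier u b.
have E2 l : 'D_(c l) ('D_(c l) barrier) u =
    (1 + 2 * a * height u) * (- 2 * edot (c l) (c l)) +
      8 * a * (edot (u - q) (c l) ^+ 2).
  by have [_] := is_derive2_barrier u (c l) (c l).
rewrite /sum_squares E1 (eq_bigr _ (fun l _ => E2 l)) big_split /= -!mulr_sumr.
ring.
Qed.

Lemma continuous_height (u : 'rV[R]_n) : {for u, continuous height}.
Proof. by apply: cont_add; [exact: cont_cst|apply: cont_opp; exact: continuous_sqr_dist]. Qed.

Lemma continuous_barrier (u : 'rV[R]_n) : {for u, continuous barrier}.
Proof.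
have ch := @continuous_height u.
by apply: cont_add => //; apply: cont_mul; [exact: cont_cst|exact: cont_mul].
Qed.

End Barrier.

Lemma sum_squares_barrier_continuous (R : realType) (n N : nat) (q : 'rV[R]_n)
    (s a : R) (c : 'I_N -> 'rV[R]_n -> 'rV[R]_n) (b : 'rV[R]_n -> 'rV[R]_n) u :
  (forall l, {for u, continuous (c l)}) -> {for u, continuous b} ->
  {for u, continuous (fun y => sum_squares (c ^~ y) (b y) (barrier q s a) y)}.
Proof.
move=> cc cb.
have -> : (fun y => sum_squares (c ^~ y) (b y) (barrier q s a) y) =
    (fun y => (1 + 2 * a * height q s y) *
      (- 2 * (\sum_l edot (c l y) (c l y) + edot (y - q) (b y))) +
    8 * a * \sum_l edot (y - q) (c l y) ^+ 2).
  by apply/funext => y; rewrite sum_squares_barrier.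
have cq := @continuous_subr R 'rV[R]_n q u.
have ch := @continuous_height R n q s u.
apply: cont_add; apply: cont_mul; try exact: cont_cst.
- by apply: cont_add; [exact: cont_cst|apply: cont_mul => //; exact: cont_cst].
- apply: cont_mul; first exact: cont_cst.
  apply: cont_add; last exact: cont_edot.
  by apply: cont_sum => l; exact: cont_edot.
- by apply: cont_sum => l; apply: cont_mul; exact: cont_edot.
Qed.

Section EuclideanGeometry.
Variables (R : realType) (m : nat).
Implicit Types u v w : 'rV[R]_m.

Lemma parallelogram u v :
  edot (u + v) (u + v) + edot (u - v) (u - v) = 2 * (edot u u + edot v v).
Proof.
rewrite !(edotDl, edotDr, edotNl, edotNr) (edotC v u); ring.
Qed.

Lemma midpointK u v : u + 2^-1 *: (v - u) + 2^-1 *: (v - u) = v.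
Proof.
rewrite -addrA -scalerDl (_ : 2^-1 + 2^-1 = 1); last lra.
by rewrite scale1r addrC subrK.
Qed.

(** The ball whose diameter is the radius from [q0] to [p] touches the sphere
    about [q0] at [p] only. *)
Lemma inner_ball q0 p u : let x := 2^-1 *: (p - q0) in
  edot (u - (q0 + x)) (u - (q0 + x)) <= edot x x -> u != p ->
  edot (u - q0) (u - q0) < edot (p - q0) (p - q0).
Proof.
move=> x ux up.
have px : p = q0 + x + x by rewrite midpointK.
set z := u - (q0 + x) in ux.
have uq : u - q0 = z + x by rewrite /z opprD addrA subrK.
have zx : u - p = z - x by rewrite /z px opprD addrA.
have pq : p - q0 = x + x by rewrite px addrAC [q0 + x]addrC addrK.
have : 0 < edot (z - x) (z - x) by rewrite edot_gt0 -zx subr_eq0.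
have := parallelogram z x; rewrite uq pq.
have -> : edot (x + x) (x + x) = 4 * edot x x by rewrite edotDl !edotDr; ring.
lra.
Qed.

End EuclideanGeometry.

Section StrongMaximum.
Variables (R : realType) (n N : nat).
Variables (U : set 'rV[R]_n) (f : 'rV[R]_n -> R) (mu : R).
Hypotheses (oU : open U) (cf : forall u, U u -> {for u, continuous f}).
Hypothesis fmu : forall u, U u -> f u <= mu.

(** If [f] takes smaller values arbitrarily near [p], then growing a ball
    around such a point until it meets the contact set [f = mu] yields a ball
    that touches the contact set at one point and lies in its complement
    otherwise. *)
Lemma touching_ball (p : 'rV[R]_n) : U p -> f p = mu ->
  ~ (\forall u \near p, f u = mu) ->
  exists q p', [/\ U p', f p' = mu, p' != q &
    forall u, U u -> 0 <= height q (edot (p' - q) (p' - q)) u -> u != p' ->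
      f u < mu].
Proof.
move=> Up fp nconst.
have [e /= e0 eU] : exists2 e : R, 0 < e &
    forall u, edot (u - p) (u - p) <= e -> U u.
  have := open_nbhs_nbhs (conj oU Up) => /nbhs_ballP[e /= e0 eU].
  exists ((e / 2) ^+ 2); first by rewrite exprn_gt0 // divr_gt0.
  move=> u ue; apply: eU; rewrite mx_norm_ball /ball_ /= distrC.
  have := le_trans (sqr_norm_le_edot _) ue; have := normr_ge0 (u - p); nra.
have [q0 [q0e fq0]] : exists q0 : 'rV[R]_n, edot (q0 - p) (q0 - p) < e / 4 /\ f q0 <> mu.
  apply: contrapT => noq; apply: nconst.
  have := near_sqr_dist p (divr_gt0 e0 (ltr0Sn R 3)).
  by apply: filterS => u ue; apply: contrapT => fu; apply: noq; exists u.
pose K := [set u : 'rV[R]_n | edot (u - p) (u - p) <= e].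
have cK : compact K := @compact_euclidean_ball R n p e.
have clC : closed (K `&` f @^-1` [set x | x = mu]).
  apply: (closed_fiber (U := U)) => //.
  by apply: compact_closed => //; exact: norm_hausdorff.
have cC : compact (K `&` f @^-1` [set x | x = mu]).
  by apply: subclosed_compact clC cK _ => u [].
have [||p' p'C p'min] := @compact_EVT_min _ R
  (fun u : 'rV[R]_n => edot (u - q0) (u - q0)) _ _ cC.
- by exists p; split => //; rewrite /K /= subrr edot0l ltW.
- by apply: continuous_subspaceT => u; exact: continuous_sqr_dist.
move: p'C; rewrite inE => -[Kp' /= fp'].
have Up' := eU _ Kp'.
have close_lt u : edot (u - q0) (u - q0) < edot (p' - q0) (p' - q0) -> f u < mu.
  move=> uq0.
  have Ku : K u.
    have : edot (p' - q0) (p' - q0) <= edot (p - q0) (p - q0).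
      by apply: p'min; rewrite inE; split => //; rewrite /K /= subrr edot0l ltW.
    have -> : edot (p - q0) (p - q0) = edot (q0 - p) (q0 - p).
      by rewrite -opprB edotNl edotNr opprK.
    have := parallelogram (u - q0) (q0 - p); rewrite addrA subrK /K /=.
    have := edot_ge0 (u - q0 - (q0 - p)); lra.
  rewrite lt_neqAle fmu ?andbT; last exact: eU.
  apply/eqP => fu; have : u \in K `&` f @^-1` [set x | x = mu] by rewrite inE.
  by move=> /p'min; rewrite leNgt uq0.
pose x := 2^-1 *: (p' - q0).
have x0 : x != 0.
  rewrite scaler_eq0 invr_eq0 pnatr_eq0 /= subr_eq0.
  by apply/eqP => pq0; apply: fq0; rewrite -pq0.
have p'x : p' - (q0 + x) = x.
  by rewrite -{1}[p'](midpointK q0) addrAC subrr add0r.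
exists (q0 + x), p'; split => //; first by rewrite -subr_eq0 p'x.
move=> u Uu; rewrite /height p'x subr_ge0 => ux up.
exact/close_lt/inner_ball.
Qed.

(** E. Hopf's argument.  At a touching point the barrier, being zero there with
    positive [sum_squares], can be added to [f] with a small factor: on the
    boundary of a small ball the sum stays below [mu], at its centre it equals
    [mu], so it has an interior maximum, against [sum_squares > 0]. *)
Theorem strong_maximum_principle
    (c : 'I_N -> 'rV[R]_n -> 'rV[R]_n) (b : 'rV[R]_n -> 'rV[R]_n) (p : 'rV[R]_n) :
  twice_derivable_on U f ->
  (forall u, U u -> forall l, {for u, continuous (c l)}) ->
  (forall u, U u -> {for u, continuous b}) ->
  (forall u v, U u -> v != 0 -> exists l, edot v (c l u) != 0) ->
  (forall u, U u -> 0 <= sum_squares (c ^~ u) (b u) f u) ->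
  U p -> f p = mu -> \forall u \near p, f u = mu.
Proof.
move=> Df cc cb ell Lf Up fp; apply: contrapT => nconst.
have [q [p' [Up' fp' p'q touch]]] := touching_ball Up fp nconst.
set s := edot (p' - q) (p' - q) in touch.
have hp' : height q s p' = 0 by rewrite /height subrr.
have x0 : p' - q != 0 by rewrite subr_eq0.
have S0 : 0 < \sum_l edot (p' - q) (c l p') ^+ 2.
  have [l xl] := ell p' _ Up' x0.
  rewrite (bigD1 l) //= ltr_wpDr ?exprn_even_gt0 // sumr_ge0 // => j _.
  exact: sqr_ge0.
set S := (X in 0 < X) in S0.
set B := \sum_l edot (c l p') (c l p') + edot (p' - q) (b p').
(* With this choice [8 * a * S = 8 * (`|B| + 1)] dominates [- 2 * B]. *)
pose a := (`|B| + 1) / S.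
have a0 : 0 < a by rewrite divr_gt0 // ltr_wpDl.
pose v := barrier q s a.
pose Lv u := sum_squares (c ^~ u) (b u) v u.
have Lvp' : 0 < Lv p'.
  rewrite /Lv sum_squares_barrier hp' -/S -/B mulr0 addr0 mul1r.
  rewrite -mulrA /a divfK ?gt_eqF //.
  by have := ler_norm B; have := normr_ge0 B; lra.
have [e /= e0 he] : exists2 e : R, 0 < e & forall u, `|u - p'| <= e ->
    [/\ U u, 0 < Lv u & 0 < 1 + a * height q s u].
  have n1 : \forall u \near p', U u := open_nbhs_nbhs (conj oU Up').
  have n2 : \forall u \near p', 0 < Lv u.
    apply: near_gt_continuous => //.
    apply: sum_squares_barrier_continuous; [exact: cc|exact: cb].
  have n3 : \forall u \near p', 0 < 1 + a * height q s u.
    apply: near_gt_continuous; last by rewrite hp' mulr0 addr0.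
    apply: cont_add; first exact: cont_cst.
    by apply: cont_mul; [exact: cont_cst|exact: continuous_height].
  have : \forall u \near p', [/\ U u, 0 < Lv u & 0 < 1 + a * height q s u].
    by move: n1 n2 n3; apply: filterS3.
  move=> /nbhs_ballP[e /= e0 he].
  exists (e / 2); first by rewrite divr_gt0.
  move=> u ue; apply: he.
  rewrite mx_norm_ball /ball_ /= distrC; lra.
pose K := [set u : 'rV[R]_n | `|u - p'| <= e].
have cn u : {for u, continuous (fun u : 'rV[R]_n => `|u - p'|)}.
  exact: continuous_dist.
have clK : closed K.
  have := @closed_comp _ _ (fun u : 'rV[R]_n => `|u - p'|) [set x | x <= e].
  by apply=> [u _|]; [exact: cn|exact: closed_le].
have cK : compact K.
  apply: bounded_closed_compact => //.
  exists (`|p'| + e); split; first exact: num_real.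
  move=> M hM u /= ue; apply: le_trans (ltW hM).
  have -> : u = p' + (u - p') by rewrite addrC subrK.
  by rewrite (le_trans (ler_normD _ _)) // lerD2l.
have cfK : {within K, continuous f}.
  by apply: continuous_in_subspaceT => u; rewrite inE => /he[Uu _ _]; exact: cf.
have vE u : v u = height q s u * (1 + a * height q s u) by rewrite /v /barrier; ring.
have [d d0 hd] : exists2 d : R, 0 < d & forall u, `|u - p'| = e -> f u + d * v u < mu.
  have sphere_le u : `|u - p'| = e -> `|u - p'| <= e by move=> ->.
  pose A := (K `&` (fun u : 'rV[R]_n => `|u - p'|) @^-1` [set x | e <= x]) `&`
    height q s @^-1` [set x | 0 <= x].
  have clA : closed A.
    apply: (closed_fiber (U := setT)) => [||u _|].
    - apply: (closed_fiber (U := setT)) => // u _; exact: cn.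
    - by [].
    - exact: continuous_height.
    - exact: closed_ge.
  have cA : compact A by apply: subclosed_compact clA cK _ => u [[]].
  have neg u : `|u - p'| = e -> ~ A u -> v u < 0.
    move=> ue nA; have [_ _ pos] := he u (sphere_le u ue).
    rewrite vE pmulr_llt0 // ltNge; apply/negP => t0; apply: nA.
    by split => //; split; rewrite /K /= ue.
  have [[u1 Au1]|noA] := pselect (A !=set0); last first.
    exists 1 => // u ue; have [Uu _ _] := he u (sphere_le u ue).
    have : v u < 0 by apply: neg => // Au; apply: noA; exists u.
    by have := fmu Uu; lra.
  have [||w] := @compact_EVT_max _ R f _ _ cA.
  - by exists u1.
  - by apply: continuous_subspaceW cfK => u [[]].
  rewrite inE => -[[Kw ew] tw] wmax.
  have [Uw _ _] := he w Kw.
  have fw : f w < mu.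
    apply: touch => //; apply/eqP => wp'.
    by move: ew; rewrite /= wp' subrr normr0 leNgt e0.
  have s0 : 0 <= s := edot_ge0 _.
  pose Vm := s * (1 + a * s).
  have Vm0 : 0 <= Vm by rewrite mulr_ge0 // addr_ge0 // mulr_ge0 // ltW.
  have Vm1 : 0 < Vm + 1 by lra.
  exists ((mu - f w) / (Vm + 1)); first by rewrite divr_gt0 // subr_gt0.
  move=> u ue; have [Uu _ _] := he u (sphere_le u ue).
  have [Au|nAu] := pselect (A u); last first.
    have : (mu - f w) / (Vm + 1) * v u < 0.
      by rewrite pmulr_rlt0 ?divr_gt0 ?subr_gt0 // neg.
    by have := fmu Uu; lra.
  have fuw : f u <= f w by apply: wmax; rewrite inE.
  have : v u < Vm + 1.
    case: Au => _ /= t0; rewrite vE.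
    have ts : height q s u <= s by rewrite /height gerBl edot_ge0.
    have : height q s u * (1 + a * height q s u) <= Vm.
      apply: ler_pM => //; first by rewrite addr_ge0 // mulr_ge0 // ltW.
      by rewrite lerD2l ler_pM2l.
    lra.
  rewrite -(ltr_pM2l (x := (mu - f w) / (Vm + 1))) ?divr_gt0 ?subr_gt0 //.
  rewrite divfK ?gt_eqF //; lra.
pose F u := f u + d * v u.
have [||w] := @compact_EVT_max _ R F _ _ cK.
- by exists p'; rewrite /K /= subrr normr0 ltW.
- apply: continuous_in_subspaceT => u; rewrite inE => /he[Uu _ _].
  apply: (@cont_add _ _ u f (fun y => d * v y)); first exact: cf.
  apply: (@cont_mul _ _ u (fun=> d) v); first exact: cont_cst.
  exact: continuous_barrier.
rewrite inE => Kw wmax.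
have Fp' : F p' = mu by rewrite /F vE hp' mul0r mulr0 addr0.
have Fw : mu <= F w.
  by rewrite -Fp'; apply: wmax; rewrite inE /K /= subrr normr0 ltW.
have we : `|w - p'| < e.
  rewrite lt_neqAle Kw andbT; apply/eqP => /hd.
  by rewrite ltNge; apply/negP; rewrite negbK.
have [Uw Lvw _] := he w Kw.
have nmax : \forall y \near w, F y <= F w.
  have := near_lt_continuous (cn w) we; apply: filterS => y ye.
  by apply: wmax; rewrite inE; exact: ltW.
have Dv : twice_derivable_on U v by exact: twice_derivable_barrier.
have DF := twice_derivable_combination d oU Df Dv.
have := sum_squares_local_max (c ^~ w) (b w) oU Uw DF nmax.
rewrite (sum_squares_combination d oU Df Dv _ _ Uw).
have : 0 < d * sum_squares (c^~ w) (b w) v w by exact: mulr_gt0.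
have := Lf w Uw; lra.
Qed.

End StrongMaximum.

(** * First and second derivatives of maps between row vector spaces *)

Section LinearComposition.
Variables (R : realType) (V W W' : normedModType R).

Lemma is_derive_linear (L : {linear W -> W'}) (f : V -> W) x v d :
  continuous L -> is_derive x v f d -> is_derive x v (L \o f) (L d).
Proof.
move=> cL [df <-].
have E : (fun h : R => h^-1 *: (((L \o f) \o shift x) (h *: v) - (L \o f) x)) =
    L \o (fun h => h^-1 *: ((f \o shift x) (h *: v) - f x)).
  by apply/funext => h /=; rewrite [RHS]linearZ [in RHS]linearB.
have cv : (fun h : R => h^-1 *: (((L \o f) \o shift x) (h *: v) - (L \o f) x)) h
    @[h --> 0^'] --> L ('D_v f x).
  by rewrite E; apply: continuous_cvg => //; exact: cL.
by apply: DeriveDef; [apply/cvg_ex; exists (L ('D_v f x))|exact: cvg_lim cv].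
Qed.

Lemma near_eq_differentiable (f g : V -> W) x :
  (\forall y \near x, f y = g y) -> differentiable f x -> differentiable g x.
Proof.
move=> fg /diff_locallyP[cdf /eqaddoP ef].
have fg0 : \forall h \near (0 : V), f (h + x) = g (h + x).
  have : (fun h : V => h + x) h @[h --> (0 : V)] --> (0 : V) + x.
    by apply: cvgD; [exact: cvg_id|exact: cvg_cst].
  by rewrite add0r => /(_ _ fg).
have eg : g \o shift x = cst (g x) + 'd f x +o_ 0 id.
  apply/eqaddoP => e e0; move: (ef e e0) fg0; apply: filterS2 => h /=.
  rewrite !fctE /= => + E; rewrite E (nbhs_singleton fg); exact.
have dE := diff_unique cdf eg.
by apply/diff_locallyP; rewrite dE.
Qed.

(** The definition of [Ck_on] mentions derivatives of functions on the whole
    space; as [U] is open they depend only on the values in [U]. *)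
Lemma Ck_on_eq (m : nat) (U : set V) (f g : V -> W) :
  open U -> (forall u, U u -> f u = g u) -> Ck_on m U f -> Ck_on m U g.
Proof.
move=> oU; have near_U u : U u -> \forall y \near u, U y.
  by move=> Uu; apply: open_nbhs_nbhs.
elim: m f g => [|m IHm] f g fg /=.
  move=> cf u Uu.
  suff : g @ u --> f u by rewrite (fg u Uu).
  apply: cvg_trans (cf u Uu); apply: near_eq_cvg.
  by apply: filterS (near_U u Uu) => y Uy; rewrite fg.
move=> [df Df]; split=> [u Uu|v]; last first.
  apply: IHm (Df v) => u Uu; apply: near_eq_derive.
  by apply: filterS (near_U u Uu) => y Uy; rewrite fg.
apply: near_eq_differentiable (df u Uu).
by apply: filterS (near_U u Uu) => y Uy; rewrite fg.
Qed.

End LinearComposition.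

Lemma Ck_on_linear (R : realType) (V W W' : normedModType R) (m : nat)
    (U : set V) (L : {linear W -> W'}) (f : V -> W) :
  open U -> continuous L -> Ck_on m U f -> Ck_on m U (L \o f).
Proof.
move=> oU cL; elim: m f => [|m IHm] f /=.
  by move=> cf u Uu; apply: continuous_comp; [exact: cf|exact: cL].
move=> [df Df]; split=> [u Uu|v].
  by apply: differentiable_comp; [exact: df|exact: linear_differentiable].
apply: (Ck_on_eq oU _ (IHm _ (Df v))) => u Uu.
have /derivableP fu := @diff_derivable _ _ _ f u v (df u Uu).
by have [_ ->] := is_derive_linear cL fu.
Qed.

Section Jacobian.
Variables (R : realType) (n p : nat).

Lemma row_jacobian (F : 'rV[R]_n -> 'rV[R]_p) u i :
  differentiable F u -> row i ('J F u) = 'D_(delta_mx 0 i) F u.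
Proof. by move=> dF; rewrite rowE deriveEjacobian. Qed.

Lemma first_formE (F : 'rV[R]_n -> 'rV[R]_p) u :
  differentiable F u -> first_form F u = 'J F u *m ('J F u)^T.
Proof.
move=> dF; apply/matrixP => i j; rewrite !mxE edot_mulmx -!row_jacobian // mxE.
by apply: eq_bigr => l _; rewrite !mxE.
Qed.

(** [v *m first_form F u *m v^T] is the squared length of ['D_v F u]. *)
Lemma first_form_unit (F : 'rV[R]_n -> 'rV[R]_p) u :
  differentiable F u -> injective ('d F u) -> first_form F u \in unitmx.
Proof.
move=> dF injF; rewrite -row_free_unit; apply: inj_row_free => v vG.
apply: injF; rewrite linear0 -deriveE // deriveEjacobian //.
apply/eqP; rewrite -edot_eq0 edot_mulmx trmx_mul mulmxA.
by rewrite -[v *m _ *m _]mulmxA -first_formE // vG mul0mx mxE.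
Qed.

Lemma derive_expansion (F : 'rV[R]_n -> 'rV[R]_p) u v :
  differentiable F u ->
  'D_v F u = \sum_i v 0 i *: 'D_(delta_mx 0 i) F u.
Proof.
move=> dF; rewrite deriveEjacobian // mulmx_sum_row.
by apply: eq_bigr => i _; rewrite row_jacobian.
Qed.

Lemma derive2_expansion (U : set 'rV[R]_n) (F : 'rV[R]_n -> 'rV[R]_p) u v w :
  open U -> Ck_on 2 U F -> U u ->
  'D_w ('D_v F) u = \sum_j \sum_i (w 0 i * v 0 j) *:
    'D_(delta_mx 0 i) ('D_(delta_mx 0 j) F) u.
Proof.
move=> oU [dF D2F] Uu.
transitivity ('D_w (\sum_j v 0 j \*: 'D_(delta_mx 0 j) F) u).
  apply: near_eq_derive; have : \forall y \near u, U y.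
    by apply: open_nbhs_nbhs.
  by apply: filterS => y Uy; rewrite derive_expansion ?fct_sumE; [|exact: dF].
have dDF j : differentiable ('D_(delta_mx 0 j) F) u by exact: (D2F _).1.
have [_ ->] : is_derive u w (\sum_j v 0 j \*: 'D_(delta_mx 0 j) F)
    (\sum_j v 0 j *: 'D_w ('D_(delta_mx 0 j) F) u).
  apply: is_derive_sum => j; apply: is_deriveZ.
  exact/derivableP/diff_derivable.
apply: eq_bigr => j _; rewrite derive_expansion // scaler_sumr.
by apply: eq_bigr => i _; rewrite scalerA mulrC.
Qed.

End Jacobian.

(** * Orthogonal decompositions *)

Section ResolutionOfIdentity.
Variables (R : realType) (n p : nat).
Variables (E : 'M[R]_(n, p)) (nu w : 'rV[R]_p).
Hypotheses (pn : p = n.+2) (Gu : E *m E^T \in unitmx).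
Hypotheses (nu1 : edot nu nu = 1) (w0 : edot w w != 0).
Hypotheses (Enu : E *m nu^T = 0) (Ew : E *m w^T = 0) (nuw : edot nu w = 0).

(** The orthogonality relations provide a right inverse of the matrix with the
    rows of [E], [nu] and [w]; by [p = n + 2] this matrix is square, so the right
    inverse is a left inverse, and that is the identity below. *)
Lemma resolution_of_identity :
  E^T *m invmx (E *m E^T) *m E + nu^T *m nu + (edot w w)^-1 *: (w^T *m w) = 1%:M.
Proof.
have mx11 (a b : 'rV[R]_p) : a *m b^T = (edot a b)%:M.
  by rewrite edot_mulmx -mx11_scalar.
pose B := col_mx E (col_mx nu w).
pose C := row_mx (E^T *m invmx (E *m E^T))
  (row_mx nu^T ((edot w w)^-1 *: w^T)).
have tr0 (a : 'rV[R]_p) : E *m a^T = 0 -> a *m E^T = 0.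
  by move=> Ea; apply: trmx_inj; rewrite trmx_mul trmxK Ea trmx0.
have BC : B *m C = 1%:M.
  rewrite /B /C mul_col_row mulmxA mulmxV //.
  rewrite mul_mx_row Enu -scalemxAr Ew scaler0 row_mx0.
  rewrite mulmxA !mul_col_mx !tr0 // !mul0mx col_mx0.
  rewrite !mul_mx_row -!scalemxAr !mx11 nu1 nuw [edot w nu]edotC nuw.
  rewrite raddf0 scaler0 scale_scalar_mx mulVf //.
  by rewrite -[col_mx _ _]/(block_mx 1%:M 0 0 1%:M) -!scalar_mx_block.
have fB : row_free B by apply/row_freeP; exists C.
have : row_full B by rewrite /row_full (eqP fB) pn !addnS addn0.
move=> /row_fullP[D DB].
have CD : C = D by rewrite -[C]mul1mx -DB -mulmxA BC mulmx1.
by rewrite -CD /C /B mul_row_col mul_row_col -scalemxAl addrA in DB.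
Qed.

End ResolutionOfIdentity.

Section TangentProjection.
Variables (R : realType) (n m1 m2 : nat).
Variables (E : 'M[R]_(n, m1 + m2)) (nu w : 'rV[R]_(m1 + m2)).
Hypotheses (pn : (m1 + m2 = n.+2)%N) (Gu : E *m E^T \in unitmx).
Hypotheses (nu1 : edot nu nu = 1) (w0 : edot w w != 0).
Hypotheses (Enu : E *m nu^T = 0) (Ew : E *m w^T = 0) (nuw : edot nu w = 0).

Let P := E^T *m invmx (E *m E^T) *m E.

Lemma orthogonal_decomposition z :
  z = z *m P + edot z nu *: nu + ((edot w w)^-1 * edot z w) *: w.
Proof.
have := resolution_of_identity pn Gu nu1 w0 Enu Ew nuw; rewrite -/P => I.
have zv v : z *m (v^T *m v) = edot z v *: v.
  by rewrite mulmxA [z *m v^T]mx11_scalar -edot_mulmx mul_scalar_mx.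
by rewrite -{1}[z]mulmx1 -I !mulmxDr -scalemxAr !zv scalerA.
Qed.

Lemma edot_delta_mx m (v : 'rV[R]_m) i : edot v (delta_mx 0 i) = v 0 i.
Proof.
rewrite /edot (bigD1 i) //= mxE !eqxx mulr1 big1 ?addr0 // => j /negPf ji.
by rewrite mxE ji andbF mulr0.
Qed.

Lemma lsubmx_delta_lshift i :
  lsubmx (delta_mx 0 (lshift m2 i) : 'rV[R]_(m1 + m2)) = delta_mx 0 i.
Proof. by apply/rowP => j; rewrite !mxE (inj_eq (@lshift_inj _ _)). Qed.

Lemma lsubmx_delta_rshift i :
  lsubmx (delta_mx 0 (rshift m1 i) : 'rV[R]_(m1 + m2)) = 0.
Proof. by apply/rowP => j; rewrite !mxE eq_lrshift andbF. Qed.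

(** The trace of the first-factor part of the tangent projection: the full
    trace [m1] is shared between the tangent space and [nu], the vector [w]
    having no first-factor part. *)
Lemma trace_tangent_projection : lsubmx w = 0 ->
  \sum_l edot (lsubmx (row l P)) (lsubmx (row l P)) =
    m1%:R - edot (lsubmx nu) (lsubmx nu).
Proof.
move=> xw; set x := lsubmx nu.
have rowP l : lsubmx (row l P) = lsubmx (delta_mx 0 l) - nu 0 l *: x.
  have := orthogonal_decomposition (delta_mx 0 l).
  rewrite -rowE [edot _ nu]edotC edot_delta_mx => /(congr1 lsubmx).
  rewrite !linearD /= [lsubmx (_ *: w)]linearZ /= xw scaler0 addr0.
  by rewrite [lsubmx (_ *: nu)]linearZ /= => ->; rewrite addrK.
have nu_split : \sum_i nu 0 (lshift m2 i) ^+ 2 + \sum_i nu 0 (rshift m1 i) ^+ 2 = 1.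
  rewrite -nu1 /edot big_split_ord /=.
  by congr (_ + _); apply: eq_bigr => i _; rewrite expr2.
have xx : \sum_i nu 0 (lshift m2 i) ^+ 2 = edot x x.
  by apply: eq_bigr => i _; rewrite !mxE expr2.
rewrite big_split_ord /=.
have -> : \sum_(i < m1) edot (lsubmx (row (lshift m2 i) P))
    (lsubmx (row (lshift m2 i) P)) =
  \sum_(i < m1) (1 + (edot x x - 2) * nu 0 (lshift m2 i) ^+ 2).
  apply: eq_bigr => i _; rewrite rowP lsubmx_delta_lshift.
  rewrite !(edotDl, edotDr, edotNl, edotNr, edotZl, edotZr).
  rewrite (edotC (delta_mx _ _) x) !edot_delta_mx !mxE !eqxx /=; ring.
have -> : \sum_(i < m2) edot (lsubmx (row (rshift m1 i) P))
    (lsubmx (row (rshift m1 i) P)) =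
  \sum_(i < m2) edot x x * nu 0 (rshift m1 i) ^+ 2.
  apply: eq_bigr => i _; rewrite rowP lsubmx_delta_rshift sub0r.
  rewrite !(edotNl, edotNr, edotZl, edotZr); ring.
rewrite big_split /= -!mulr_sumr sumr_const card_ord xx.
have -> : \sum_i nu 0 (rshift m1 i) ^+ 2 = 1 - edot x x.
  by rewrite -nu_split xx addrC addKr.
ring.
Qed.

End TangentProjection.

(** * The tangential Laplacian in a parametrisation *)

Section Frame.
Variables (R : realType) (n p : nat) (F : 'rV[R]_n -> 'rV[R]_p) (u : 'rV[R]_n).

(** Coordinates of the tangential parts of the standard basis vectors of the
    ambient space: their derivatives along [F] are the rows of the orthogonal
    projection onto the tangent space, and their Gram matrix is the inverse of
    the first fundamental form. *)
Definition frame_mx : 'M[R]_(p, n) := ('J F u)^T *m invmx (first_form F u).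

Definition frame (l : 'I_p) : 'rV[R]_n := row l frame_mx.

(** Contraction of the second derivatives of [F] with the inverse metric. *)
Definition metric_trace : 'rV[R]_p :=
  \sum_l 'D_(frame l) ('D_(frame l) F) u.

(** Chosen so that [sum_squares] with this drift kills the tangential component
    of [metric_trace], which carries the Christoffel symbols. *)
Definition drift : 'rV[R]_n := - (metric_trace *m frame_mx).

Hypotheses (dF : differentiable F u) (Gu : first_form F u \in unitmx).

Lemma trmx_first_form : (first_form F u)^T = first_form F u.
Proof. by rewrite first_formE // trmx_mul trmxK. Qed.

Lemma frame_gram : frame_mx^T *m frame_mx = invmx (first_form F u).
Proof.
rewrite /frame_mx trmx_mul trmxK trmx_inv trmx_first_form mulmxA.
by rewrite -[_ *m _ *m ('J F u)^T]mulmxA -first_formE // mulVmx // mul1mx.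
Qed.

Lemma sum_frame (V : lmodType R) (B : 'I_n -> 'I_n -> V) :
  \sum_l \sum_j \sum_i (frame l 0 i * frame l 0 j) *: B i j =
    \sum_j \sum_i invmx (first_form F u) i j *: B i j.
Proof.
rewrite exchange_big /=; apply: eq_bigr => j _.
rewrite exchange_big /=; apply: eq_bigr => i _.
rewrite -scaler_suml -frame_gram; congr (_ *: _).
by rewrite mxE; apply: eq_bigr => l _; rewrite !mxE.
Qed.

(** The squares of these products sum to [v *m invmx (first_form F u) *m v^T]. *)
Lemma frame_elliptic v : v != 0 -> exists l, edot v (frame l) != 0.
Proof.
move=> v0; apply/existsP; apply: contraNT v0.
rewrite negb_exists => /forallP v0.
have vC : v *m frame_mx^T = 0.
  apply/rowP => l; have := v0 l; rewrite negbK [RHS]mxE => /eqP <-.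
  by rewrite mxE; apply: eq_bigr => i _; rewrite !mxE.
have : v *m (frame_mx^T *m frame_mx) = 0 by rewrite mulmxA vC mul0mx.
rewrite frame_gram => vG.
by rewrite -[v](mulmxKV Gu) vG mul0mx.
Qed.

End Frame.

(** * Hypersurface patches of the cylinder *)

(** Differentiating the constant [edot f f] once and twice: [f1] is the
    derivative of [f] along [v], and [f2] that of [f1] along [w]. *)
Lemma derive_constant_norm (R : realType) (V : normedModType R) m (c : R)
    (f f1 : V -> 'rV[R]_m) x v w fw f2 :
  (\forall y \near x, edot (f y) (f y) = c) ->
  (\forall y \near x, is_derive y v f (f1 y)) ->
  is_derive x w f fw -> is_derive x w f1 f2 ->
  edot (f x) (f1 x) = 0 /\ edot (f x) f2 = - edot fw (f1 x).
Proof.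
move=> fc df dw dvw.
have first_order : \forall y \near x, edot (f y) (f1 y) = 0.
  move: (near_join fc) df; apply: filterS2 => y fcy dfy.
  have [_ d1] := is_derive_edot dfy dfy.
  have d2 : 'D_v (fun z => edot (f z) (f z)) y = 0.
    by rewrite (near_eq_derive _ (g := cst c)) ?derive_cst.
  move: d1; rewrite d2 (edotC (f1 y)) => /esym/eqP.
  by rewrite -mulr2n mulrn_eq0 /= => /eqP.
split; first exact: nbhs_singleton first_order.
have [_ d1] := is_derive_edot dw dvw.
have d2 : 'D_w (fun z => edot (f z) (f1 z)) x = 0.
  by rewrite (near_eq_derive _ (g := cst (0 : R))) ?derive_cst.
by move: d1; rewrite d2 => /esym/eqP; rewrite addrC addr_eq0 => /eqP.
Qed.

Section CylinderGradient.
Variables (R : realType) (n k : nat).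
Implicit Types z v : ambient R n k.

Lemma cyl_proj_horizontal z (x : 'rV[R]_(n.+1 - k)) :
  cyl_proj z (row_mx x 0) = row_mx x 0.
Proof. by rewrite /cyl_proj row_mxKr edot0l mul0r scale0r subr0. Qed.

Lemma cyl_grad_potential z :
  cyl_grad (@potential R n k) z = row_mx (2^-1 *: lsubmx z) 0.
Proof.
rewrite /cyl_grad -[RHS](cyl_proj_horizontal z); congr cyl_proj.
have d v : 'D_v (@potential R n k) z = 2^-1 * edot (lsubmx z) (lsubmx v).
  have dl : is_derive z v (lsubmx : ambient R n k -> 'rV[R]_(n.+1 - k)) (lsubmx v).
    exact: (is_derive_linear (@continuous_lsubmx R 1 (n.+1 - k) k.+1)
      (is_derive_id z v)).
  have dp := is_derive_combination (4^-1) (is_derive_cst (0 : R) z v)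
    (is_derive_edot dl dl).
  have -> : @potential R n k =
      fun y => 0 + 4^-1 * edot (lsubmx y) (lsubmx y).
    by apply/funext => y; rewrite /potential enorm_sqr add0r mulrC.
  by have [_ ->] := dp; rewrite (edotC (lsubmx v)); field.
apply/rowP => i; rewrite mxE d; case: (split_ordP i) => j ->.
  by rewrite lsubmx_delta_lshift edot_delta_mx row_mxEl !mxE.
by rewrite lsubmx_delta_rshift edot0r mulr0 row_mxEr mxE.
Qed.

Lemma outward_normalE z : lsubmx z != 0 ->
  outward_normal z = (enorm (lsubmx z))^-1 *: row_mx (lsubmx z) 0.
Proof.
move=> z0; rewrite /outward_normal cyl_grad_potential.
set x := lsubmx z in z0 *.
have -> : row_mx (2^-1 *: x) 0 = 2^-1 *: row_mx x (0 : 'rV[R]_k.+1).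
  by rewrite scale_row_mx scaler0.
have x0 : 0 < enorm x by rewrite sqrtr_gt0 edot_gt0.
have -> : enorm (2^-1 *: row_mx x (0 : 'rV[R]_k.+1)) = 2^-1 * enorm x.
  apply/eqP; rewrite -(@eqrXn2 _ 2) ?mulr_ge0 ?sqrtr_ge0 ?invr_ge0 //.
  rewrite exprMn !enorm_sqr edotZl edotZr edot_lrsubmx row_mxKl row_mxKr.
  by rewrite edot0l addr0 mulrA expr2.
rewrite scalerA invfM invrK; congr (_ *: _).
by rewrite mulrAC mulfV ?mul1r // pnatr_eq0.
Qed.

End CylinderGradient.

(** A hypersurface [F] parametrised by an open set, with its unit normal field
    [nu]: what the geometry in one chart amounts to. *)
Record cylinder_patch (R : realType) (n k : nat) (U : set 'rV[R]_n)
    (F nu : 'rV[R]_n -> ambient R n k) : Prop := CylinderPatch {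
  cp_open : open U;
  cp_C2 : Ck_on 2 U F;
  cp_cylinder : forall u, U u -> cylinder (F u);
  cp_immersion : forall u, U u -> injective ('d F u);
  cp_unit : forall u, U u -> enorm (nu u) = 1;
  cp_proj : forall u, U u -> cyl_proj (F u) (nu u) = nu u;
  cp_normal : forall u, U u -> forall v, edot (nu u) ('D_v F u) = 0
}.

Section Patch.
Variables (R : realType) (n k : nat).
Variables (U : set 'rV[R]_n) (F nu : 'rV[R]_n -> ambient R n k) (h : R).
Hypotheses (hk : (k <= n)%N) (hk2 : (2 <= k)%N) (patchF : cylinder_patch U F nu).

Let oU := cp_open patchF.
Let C2F := cp_C2 patchF.
Let cylF := cp_cylinder patchF.
Let nu_tan := cp_normal patchF.

Let near_U u : U u -> \forall y \near u, U y.
Proof. by move=> Uu; apply: open_nbhs_nbhs. Qed.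

Lemma patch_differentiable u : U u -> differentiable F u.
Proof. exact: C2F.1. Qed.

Lemma patch_differentiable2 u v : U u -> differentiable ('D_v F) u.
Proof. exact: (C2F.2 v).1. Qed.

Lemma patch_metric u : U u -> first_form F u \in unitmx.
Proof.
move=> Uu; apply: first_form_unit (cp_immersion patchF Uu); exact: patch_differentiable.
Qed.

Lemma patch_radius_gt0 u : U u -> 0 < edot (rsubmx (F u)) (rsubmx (F u)).
Proof.
move=> Uu; have [_ Fy] := cylF Uu.
rewrite -enorm_sqr Fy sqr_sqrtr ?mulr_ge0 ?ler0n //.
by rewrite mulr_gt0 ?ltr0n // subn_gt0.
Qed.

Lemma patch_nu_edot u : U u -> edot (nu u) (nu u) = 1.
Proof. by move=> Uu; rewrite -enorm_sqr (cp_unit patchF Uu) expr1n. Qed.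

Lemma patch_nu_radial u : U u -> edot (rsubmx (nu u)) (rsubmx (F u)) = 0.
Proof.
move=> Uu; have y0 := patch_radius_gt0 Uu.
move: (cp_proj patchF Uu); rewrite /cyl_proj => /eqP.
rewrite -subr_eq0 addrAC subrr add0r oppr_eq0 scaler_eq0 mulf_eq0 invr_eq0.
rewrite (gt_eqF y0) orbF => /orP[/eqP //|/eqP /(congr1 rsubmx)].
by rewrite row_mxKr linear0 => yE; move: y0; rewrite yE edot0l ltxx.
Qed.

Let radial u : ambient R n k := row_mx 0 (rsubmx (F u)).

Let edot_radial u z : edot z (radial u) = edot (rsubmx z) (rsubmx (F u)).
Proof. by rewrite edot_lrsubmx row_mxKl row_mxKr edot0r add0r. Qed.

Lemma is_derive_lsubmx u v : U u ->
  is_derive u v (fun y => lsubmx (F y)) (lsubmx ('D_v F u)).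
Proof.
move=> Uu; apply: (is_derive_linear (@continuous_lsubmx R 1 _ _)).
by apply: derivableP; apply: diff_derivable; exact: patch_differentiable.
Qed.

Lemma is_derive2_lsubmx u v w : U u ->
  is_derive u w (fun y => lsubmx ('D_v F y)) (lsubmx ('D_w ('D_v F) u)).
Proof.
move=> Uu; apply: (is_derive_linear (@continuous_lsubmx R 1 _ _)).
by apply: derivableP; apply: diff_derivable; exact: patch_differentiable2.
Qed.

Lemma is_derive_rsubmx u v : U u ->
  is_derive u v (fun y => rsubmx (F y)) (rsubmx ('D_v F u)).
Proof.
move=> Uu; apply: (is_derive_linear (@continuous_rsubmx R 1 _ _)).
by apply: derivableP; apply: diff_derivable; exact: patch_differentiable.
Qed.

Lemma is_derive2_rsubmx u v w : U u ->
  is_derive u w (fun y => rsubmx ('D_v F y)) (rsubmx ('D_w ('D_v F) u)).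
Proof.
move=> Uu; apply: (is_derive_linear (@continuous_rsubmx R 1 _ _)).
by apply: derivableP; apply: diff_derivable; exact: patch_differentiable2.
Qed.

Lemma patch_radial_derivatives u v : U u ->
  edot (rsubmx (F u)) (rsubmx ('D_v F u)) = 0 /\
  edot (rsubmx (F u)) (rsubmx ('D_v ('D_v F) u)) =
    - edot (rsubmx ('D_v F u)) (rsubmx ('D_v F u)).
Proof.
move=> Uu; apply: (derive_constant_norm (c := cyl_radius R k ^+ 2)
  (f := fun y => rsubmx (F y)) (f1 := fun y => rsubmx ('D_v F y)) _ _
  (is_derive_rsubmx v Uu) (is_derive2_rsubmx v v Uu)).
  by apply: filterS (near_U Uu) => y /cylF[_ Fy]; rewrite -enorm_sqr Fy.
by apply: filterS (near_U Uu) => y; exact: is_derive_rsubmx.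
Qed.

Lemma patch_tangent_radial u v : U u -> edot ('D_v F u) (radial u) = 0.
Proof.
by move=> Uu; rewrite edot_radial edotC (patch_radial_derivatives v Uu).1.
Qed.

Let mx_edot0 (E : 'M[R]_(n, _)) (z : ambient R n k) :
  (forall i, edot (row i E) z = 0) -> E *m z^T = 0.
Proof.
move=> Ez; apply/matrixP => i j; rewrite ord1 [RHS]mxE -(Ez i) edot_mulmx.
by rewrite -row_mul [RHS]mxE.
Qed.

Lemma patch_dimension : (n.+1 - k + k.+1 = n.+2)%N.
Proof. by rewrite addnS subnK // leqW. Qed.

Section AtPoint.
Variable u : 'rV[R]_n.
Hypothesis Uu : U u.

Let dF := patch_differentiable Uu.
Let E := 'J F u.
Let P := E^T *m invmx (E *m E^T) *m E.

Let Gu : E *m E^T \in unitmx.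
Proof. by rewrite -first_formE //; exact: patch_metric. Qed.

Let Enu : E *m (nu u)^T = 0.
Proof. by apply: mx_edot0 => i; rewrite row_jacobian // edotC nu_tan. Qed.

Let Ew : E *m (radial u)^T = 0.
Proof. by apply: mx_edot0 => i; rewrite row_jacobian // patch_tangent_radial. Qed.

Let nuw : edot (nu u) (radial u) = 0.
Proof. by rewrite edot_radial patch_nu_radial. Qed.

Let w0 : edot (radial u) (radial u) != 0.
Proof. by rewrite edot_radial row_mxKr gt_eqF // patch_radius_gt0. Qed.

Lemma frame_mx_jacobian : frame_mx F u *m E = P.
Proof. by rewrite /frame_mx first_formE. Qed.

(** Tangential, normal and radial parts; the tangential one is displayed as the
    derivative of [F] along a vector of coordinates. *)
Lemma patch_decomposition z : z = 'D_(z *m frame_mx F u) F u +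
  edot z (nu u) *: nu u +
  ((edot (radial u) (radial u))^-1 * edot z (radial u)) *: radial u.
Proof.
rewrite deriveEjacobian // -mulmxA frame_mx_jacobian.
exact: orthogonal_decomposition patch_dimension Gu (patch_nu_edot Uu) w0 Enu Ew nuw z.
Qed.

Lemma derive_frame l : 'D_(frame F u l) F u = row l P.
Proof. by rewrite deriveEjacobian // -row_mul frame_mx_jacobian. Qed.

(** The radial correction in [cyl_nabla] is orthogonal to the normal, so only the
    flat second derivatives of [F] contribute. *)
Lemma mean_curvature_trace :
  \tr (invmx (first_form F u) *m second_form F (nu u) u) =
    edot (metric_trace F u) (nu u).
Proof.
rewrite /metric_trace.
under eq_bigr => l _ do rewrite (derive2_expansion _ _ oU C2F Uu).
rewrite sum_frame //; last exact: patch_metric.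
rewrite edot_suml; apply: eq_bigr => j _.
rewrite edot_suml mxE; apply: eq_bigr => i _.
rewrite edotZl [second_form _ _ _ _ _]mxE /cyl_nabla /cyl_proj.
rewrite edotDl edotNl edotZl (edotC (row_mx _ _)) -/(radial u) nuw mulr0 subr0.
by rewrite -[in LHS](trmx_first_form dF) -trmx_inv mxE.
Qed.

End AtPoint.

Definition horizontal_sqr (y : 'rV[R]_n) : R :=
  edot (lsubmx (F y)) (lsubmx (F y)).

Lemma is_derive_horizontal_sqr u v : U u ->
  is_derive u v horizontal_sqr (2 * edot (lsubmx (F u)) (lsubmx ('D_v F u))).
Proof.
move=> Uu; have d := is_derive_lsubmx v Uu.
apply: is_derive_val_eq (is_derive_edot d d) _.
by rewrite (edotC (lsubmx ('D_v F u))); ring.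
Qed.

Lemma is_derive2_horizontal_sqr u v w : U u ->
  is_derive u w ('D_v horizontal_sqr)
    (2 * (edot (lsubmx ('D_w F u)) (lsubmx ('D_v F u)) +
          edot (lsubmx (F u)) (lsubmx ('D_w ('D_v F) u)))).
Proof.
move=> Uu.
apply: (@near_eq_is_derive _ _ _
  (fun y => 0 + 2 * edot (lsubmx (F y)) (lsubmx ('D_v F y)))).
  apply: filterS (near_U Uu) => y Uy.
  by have [_ ->] := is_derive_horizontal_sqr v Uy; rewrite add0r.
have d := is_derive_edot (is_derive_lsubmx w Uu) (is_derive2_lsubmx v w Uu).
have := is_derive_combination 2 (is_derive_cst (0 : R) u w) d.
by rewrite add0r.
Qed.

Lemma twice_derivable_horizontal_sqr : twice_derivable_on U horizontal_sqr.
Proof.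
move=> u Uu v; split=> [|w]; first by have [] := is_derive_horizontal_sqr v Uu.
by have [] := is_derive2_horizontal_sqr v w Uu.
Qed.

Lemma continuous_horizontal_sqr u : U u -> {for u, continuous horizontal_sqr}.
Proof.
move=> Uu; have cF : {for u, continuous F}.
  by apply: differentiable_continuous; exact: patch_differentiable.
have cl : {for u, continuous (fun y => lsubmx (F y))}.
  by apply: continuous_comp cF _; exact: continuous_lsubmx.
exact: cont_edot.
Qed.

Let horizontal (z : ambient R n k) : ambient R n k := row_mx (lsubmx z) 0.

Let edot_horizontal (z z' : ambient R n k) :
  edot (lsubmx z) (lsubmx z') = edot (horizontal z) z'.
Proof. by rewrite [RHS]edot_lrsubmx row_mxKl row_mxKr edot0l addr0. Qed.

(** Up to the drift, the Laplacian of the squared distance to the axis: the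
    trace of the horizontal metric plus the effect of the mean curvature. *)
Lemma sum_squares_horizontal_sqr u : U u ->
  sum_squares (frame F u) (drift F u) horizontal_sqr u =
    2 * ((n.+1 - k)%:R - edot (lsubmx (nu u)) (lsubmx (nu u))) +
    2 * edot (lsubmx (F u)) (lsubmx (nu u)) *
      \tr (invmx (first_form F u) *m second_form F (nu u) u).
Proof.
move=> Uu; set X := horizontal (F u).
have E1 : 'D_(drift F u) horizontal_sqr u = 2 * edot X ('D_(drift F u) F u).
  by have [_ ->] := is_derive_horizontal_sqr (drift F u) Uu; rewrite edot_horizontal.
have E2 l : 'D_(frame F u l) ('D_(frame F u l) horizontal_sqr) u =
    2 * edot (lsubmx ('D_(frame F u l) F u)) (lsubmx ('D_(frame F u l) F u)) +
    2 * edot ('D_(frame F u l) ('D_(frame F u l) F) u) X.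
  have [_ ->] := is_derive2_horizontal_sqr (frame F u l) (frame F u l) Uu.
  by rewrite (edot_horizontal (F u)) (edotC X) mulrDr.
rewrite /sum_squares E1 (eq_bigr _ (fun l _ => E2 l)) big_split /= -!mulr_sumr.
rewrite -edot_suml -/(metric_trace F u).
have -> : \sum_l edot (lsubmx ('D_(frame F u l) F u)) (lsubmx ('D_(frame F u l) F u)) =
    (n.+1 - k)%:R - edot (lsubmx (nu u)) (lsubmx (nu u)).
  under eq_bigr => l _ do rewrite (derive_frame Uu).
  apply: (trace_tangent_projection patch_dimension (w := row_mx 0 (rsubmx (F u)))).
  - by rewrite -first_formE; [exact: patch_metric|exact: patch_differentiable].
  - exact: patch_nu_edot.
  - by rewrite edot_radial row_mxKr gt_eqF // patch_radius_gt0.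
  - apply: mx_edot0 => i; rewrite row_jacobian; last exact: patch_differentiable.
    by rewrite edotC nu_tan.
  - apply: mx_edot0 => i; rewrite row_jacobian; last exact: patch_differentiable.
    exact: patch_tangent_radial.
  - by rewrite edot_radial patch_nu_radial.
  - by rewrite row_mxKl.
rewrite mean_curvature_trace // edot_horizontal -/X -addrA -mulrDr; congr (_ + _).
have := patch_decomposition Uu (metric_trace F u) => /(congr1 (edot X)).
have Xr : edot X (radial u) = 0 by rewrite edot_radial row_mxKr edot0l.
rewrite !edotDr !edotZr Xr mulr0 addr0 (edotC X (metric_trace F u)) => ->.
rewrite -mulrA; congr (_ * _).
have dF := patch_differentiable Uu.
rewrite !deriveEjacobian // /drift mulNmx edotNr.
rewrite (edot_horizontal (F u) (nu u)) -/X; ring.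
Qed.

Lemma patch_jacobian_continuous u i j : U u ->
  {for u, continuous (fun y => 'J F y i j)}.
Proof.
move=> Uu.
apply: (@cont_near_eq _ _ _ (fun y => 'D_(delta_mx 0 i) F y 0 j)).
  apply: filterS (near_U Uu) => y Uy.
  by rewrite -row_jacobian ?mxE //; exact: patch_differentiable.
by apply: cont_coord; apply: differentiable_continuous; exact: patch_differentiable2.
Qed.

Lemma patch_first_form_continuous u i j : U u ->
  {for u, continuous (fun y => first_form F y i j)}.
Proof.
move=> Uu.
have -> : (fun y => first_form F y i j) = (fun y =>
    edot ('D_(delta_mx 0 i) F y) ('D_(delta_mx 0 j) F y)).
  by apply/funext => y; rewrite mxE.
by apply: cont_edot; apply: differentiable_continuous; exact: patch_differentiable2.
Qed.

Lemma patch_inverse_continuous u i j : U u ->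
  {for u, continuous (fun y => invmx (first_form F y) i j)}.
Proof.
move=> Uu; apply: cont_invmx.
  by apply: filterS (near_U Uu) => y; exact: patch_metric.
by move=> i' j'; exact: patch_first_form_continuous.
Qed.

Lemma patch_frame_mx_continuous u i j : U u ->
  {for u, continuous (fun y => frame_mx F y i j)}.
Proof.
move=> Uu; under [X in {for _, continuous X}]eq_fun do rewrite mxE.
apply: cont_sum => l; apply: cont_mul; last exact: patch_inverse_continuous.
under [X in {for _, continuous X}]eq_fun do rewrite mxE.
exact: patch_jacobian_continuous.
Qed.

Lemma patch_frame_continuous u l : U u -> {for u, continuous (fun y => frame F y l)}.
Proof.
move=> Uu; apply: cont_mx => i j.
under [X in {for _, continuous X}]eq_fun do rewrite mxE.
exact: patch_frame_mx_continuous.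
Qed.

Lemma patch_metric_trace_continuous u j : U u ->
  {for u, continuous (fun y => metric_trace F y 0 j)}.
Proof.
move=> Uu; apply: (@cont_near_eq _ _ _ (fun y => \sum_j' \sum_i
    invmx (first_form F y) i j' *
      'D_(delta_mx 0 i) ('D_(delta_mx 0 j') F) y 0 j)).
  apply: filterS (near_U Uu) => y Uy; rewrite /metric_trace.
  under [in RHS]eq_bigr => l _ do rewrite (derive2_expansion _ _ oU C2F Uy).
  rewrite sum_frame; [|exact: patch_differentiable|exact: patch_metric].
  rewrite summxE; apply: eq_bigr => j' _; rewrite summxE; apply: eq_bigr => i _.
  by rewrite [RHS]mxE.
apply: cont_sum => j'; apply: cont_sum => i; apply: cont_mul.
  exact: patch_inverse_continuous.
by apply: cont_coord; exact: ((C2F.2 _).2 _).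
Qed.

Lemma patch_drift_continuous u : U u -> {for u, continuous (drift F)}.
Proof.
move=> Uu; apply: cont_mx => i j.
under [X in {for _, continuous X}]eq_fun do rewrite !mxE.
apply: cont_opp; apply: cont_sum => l; rewrite ord1; apply: cont_mul.
  exact: patch_metric_trace_continuous.
exact: patch_frame_mx_continuous.
Qed.


(** ** Constant weighted mean curvature *)

Hypothesis cwmcF : forall u, U u ->
  weighted_mean_curvature_vector F (nu u) u = - h *: nu u.

Let phi := horizontal_sqr.
Let p u := edot (lsubmx (F u)) (lsubmx (nu u)).
Let s2 u := edot (lsubmx (nu u)) (lsubmx (nu u)).
Let lap u := sum_squares (frame F u) (drift F u) phi u.

Let s2_le1 u : U u -> s2 u <= 1.
Proof.
move=> Uu; rewrite -(patch_nu_edot Uu) (edot_lrsubmx (nu u)) lerDl.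
exact: edot_ge0.
Qed.

Lemma patch_laplacian u : U u ->
  lap u = 2 * ((n.+1 - k)%:R - s2 u) - 2 * h * p u - p u ^+ 2.
Proof.
move=> Uu; rewrite /lap /phi sum_squares_horizontal_sqr // -/(s2 u) -/(p u).
have := cwmcF Uu; move=> /(congr1 (edot (nu u))).
rewrite /weighted_mean_curvature_vector /mean_curvature_vector.
rewrite edotDr !edotZr patch_nu_edot // !mulr1 cyl_grad_potential.
rewrite (edot_lrsubmx (row_mx _ _)) row_mxKl row_mxKr edot0l addr0 edotZl -/(p u).
set H := \tr _ => E; have -> : H = - h - 2^-1 * p u by rewrite -E addrK.
by field.
Qed.

Let p_sqr u : p u ^+ 2 <= phi u * s2 u.
Proof. exact: edot_cauchy_schwarz. Qed.

Section Inside.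
Variable r : R.
Hypotheses (r0 : 0 < r) (hr : r ^+ 2 + 2 * `|h| * r = 2 * (n - k)%:R).

Let codim : (n.+1 - k)%:R = (n - k)%:R + 1 :> R.
Proof. by rewrite subSn // -natr1. Qed.

(** With [n + 1 - k = (n - k) + 1] and the equation of [r],
    [lap u = 2 (1 - s2 u) + 2 (|h| r - h p u) + (r ^+ 2 - p u ^+ 2)],
    and the three terms are nonnegative. *)
Lemma patch_subharmonic u : U u -> phi u <= r ^+ 2 -> 0 <= lap u.
Proof.
move=> Uu phir; rewrite patch_laplacian // codim.
have s1 := s2_le1 Uu; have ps := p_sqr u.
have pr : p u ^+ 2 <= r ^+ 2.
  apply: le_trans ps _; apply: le_trans phir; rewrite ler_piMr //.
  exact: edot_ge0.
have pr1 : `|p u| <= r by apply: norm_le_of_sqr => //; exact: ltW.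
have hp : h * p u <= `|h| * r.
  by apply: le_trans (ler_norm _) _; rewrite normrM ler_wpM2l.
by move: hr; lra.
Qed.

(** A sum of nonnegative terms that is not positive has only zero terms. *)
Lemma patch_equality u : U u -> phi u <= r ^+ 2 -> lap u <= 0 ->
  [/\ s2 u = 1, phi u = r ^+ 2, p u ^+ 2 = r ^+ 2 & h * p u = `|h| * r].
Proof.
move=> Uu phir; rewrite patch_laplacian // codim => L0.
have s1 := s2_le1 Uu; have ps := p_sqr u.
have ps1 : phi u * s2 u <= phi u by rewrite ler_piMr // edot_ge0.
have pr : p u ^+ 2 <= r ^+ 2 by apply: le_trans ps _; exact: le_trans phir.
have pr1 : `|p u| <= r by apply: norm_le_of_sqr => //; exact: ltW.
have hp : h * p u <= `|h| * r.
  by apply: le_trans (ler_norm _) _; rewrite normrM ler_wpM2l.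
by move: hr => hr'; split; lra.
Qed.

Lemma patch_local_max u : U u -> phi u <= r ^+ 2 ->
  (\forall y \near u, phi y <= phi u) ->
  [/\ s2 u = 1, phi u = r ^+ 2, p u ^+ 2 = r ^+ 2 & h * p u = `|h| * r].
Proof.
move=> Uu phir pmax; apply: patch_equality => //.
apply: sum_squares_local_max oU Uu _ pmax; exact: twice_derivable_horizontal_sqr.
Qed.

Lemma patch_strong_maximum u : (forall y, U y -> phi y <= r ^+ 2) ->
  U u -> phi u = r ^+ 2 -> \forall y \near u, phi y = r ^+ 2.
Proof.
move=> phir Uu pu.
apply: (strong_maximum_principle oU continuous_horizontal_sqr phir
  (c := fun l y => frame F y l) (b := drift F)
  twice_derivable_horizontal_sqr _ _ _ _ Uu pu).
- by move=> y Uy l; exact: patch_frame_continuous.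
- exact: patch_drift_continuous.
- move=> y v Uy; apply: frame_elliptic; last exact: patch_metric.
  exact: patch_differentiable.
- by move=> y Uy; apply: patch_subharmonic => //; exact: phir.
Qed.

Section Constant.
Hypothesis phir : forall u, U u -> phi u = r ^+ 2.

Lemma patch_constant u : U u ->
  [/\ s2 u = 1, phi u = r ^+ 2, p u ^+ 2 = r ^+ 2 & h * p u = `|h| * r].
Proof.
move=> Uu; apply: patch_local_max => //; first by rewrite phir.
by apply: filterS (near_U Uu) => y Uy; rewrite !phir.
Qed.

(** The equality case of the Cauchy-Schwarz inequality. *)
Lemma patch_normal u : U u -> row_mx (lsubmx (F u)) 0 = p u *: nu u.
Proof.
move=> Uu; have [su pu ppu _] := patch_constant Uu.
have nr : rsubmx (nu u) = 0.
  apply/eqP; rewrite -edot_eq0; have := patch_nu_edot Uu.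
  rewrite (edot_lrsubmx (nu u)) -/(s2 u) su => /eqP.
  by rewrite eq_sym addrC -subr_eq subrr eq_sym.
rewrite -[nu u]hsubmxK nr scale_row_mx scaler0; congr row_mx.
apply/eqP; rewrite -subr_eq0 -edot_eq0; apply/eqP.
rewrite !(edotDl, edotDr, edotNl, edotNr, edotZl, edotZr).
rewrite (edotC (lsubmx (nu u)) (lsubmx (F u))) -/(p u) -/(s2 u) su.
rewrite -[edot _ _]/(phi u) pu -ppu; ring.
Qed.

Lemma patch_outward u : U u ->
  outward_normal (F u) = (r^-1 * p u) *: nu u.
Proof.
move=> Uu; rewrite outward_normalE; last first.
  by rewrite -edot_gt0 -[edot _ _]/(phi u) phir // exprn_gt0.
rewrite patch_normal // scalerA; congr ((_^-1 * _) *: _).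
by rewrite /enorm -[edot _ _]/(phi u) phir // sqrtr_sqr gtr0_norm.
Qed.

(** Quadratic in the normal, so that a change of orientation changes the sign of
    the weighted mean curvature but not the vector. *)
Lemma weighted_mean_curvature_scale (G : 'rV[R]_n -> ambient R n k) v a u :
  weighted_mean_curvature_vector G (a *: v) u =
    a ^+ 2 *: weighted_mean_curvature_vector G v u.
Proof.
rewrite /weighted_mean_curvature_vector /mean_curvature_vector.
have -> : second_form G (a *: v) u = a *: second_form G v u.
  by apply/matrixP => i j; rewrite !mxE edotZr.
rewrite -scalemxAr mxtraceZ edotZr scalerDr !scalerA; congr (_ *: _ + _ *: _); ring.
Qed.

Lemma patch_outward_curvature u : U u ->
  weighted_mean_curvature_vector F (outward_normal (F u)) u =
    - `|h| *: outward_normal (F u).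
Proof.
move=> Uu; rewrite patch_outward // weighted_mean_curvature_scale cwmcF //.
have [_ _ _ hp] := patch_constant Uu.
have -> : `|h| = r^-1 * (h * p u) by rewrite hp mulrCA mulVf ?gt_eqF // mulr1.
by rewrite !scalerA; congr (_ *: _); ring.
Qed.

Lemma patch_horizontal_derivatives u v : U u ->
  edot (lsubmx (F u)) (lsubmx ('D_v ('D_v F) u)) =
    - edot (lsubmx ('D_v F u)) (lsubmx ('D_v F u)).
Proof.
move=> Uu; apply: (derive_constant_norm (c := r ^+ 2)
  (f := fun y => lsubmx (F y)) (f1 := fun y => lsubmx ('D_v F y)) _ _
  (is_derive_lsubmx v Uu) (is_derive2_lsubmx v v Uu)).2.
  by apply: filterS (near_U Uu) => y /phir.
by apply: filterS (near_U Uu) => y; exact: is_derive_lsubmx.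
Qed.

Lemma patch_tangent_vector u z : U u -> edot z (nu u) = 0 ->
  edot z (radial u) = 0 -> 'D_(z *m frame_mx F u) F u = z.
Proof.
move=> Uu znu zr; rewrite [RHS](patch_decomposition Uu z) znu zr.
by rewrite mulr0 !scale0r !addr0.
Qed.

(** At a maximum of the height function [edot (F y) z0] the vector [z0] is normal
    to the hypersurface, so its two components are signed multiples of those of
    [F u]. A minus sign in a factor would make the second derivative positive
    along that factor. *)
Lemma patch_height_max z0 u : (2 <= n.+1 - k)%N ->
  edot (lsubmx z0) (lsubmx z0) = r ^+ 2 ->
  edot (rsubmx z0) (rsubmx z0) = cyl_radius R k ^+ 2 ->
  U u -> (\forall y \near u, edot (F y) z0 <= edot (F u) z0) -> F u = z0.
Proof.
move=> m2 z0x z0y Uu hmax.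
have d1 y v : U y -> is_derive y v (fun y => edot (F y) z0) (edot ('D_v F y) z0).
  move=> Uy; have dy : is_derive y v F ('D_v F y).
    by apply: derivableP; apply: diff_derivable; exact: patch_differentiable.
  apply: is_derive_val_eq (is_derive_edot dy (is_derive_cst z0 y v)) _.
  by rewrite edot0r addr0.
have d2 y v w : U y -> is_derive y w ('D_v (fun y => edot (F y) z0))
    (edot ('D_w ('D_v F) y) z0).
  move=> Uy; apply: (@near_eq_is_derive _ _ _ (fun y => edot ('D_v F y) z0)).
    by apply: filterS (near_U Uy) => y' /(d1 _ v)[_ ->].
  have dy : is_derive y w ('D_v F) ('D_w ('D_v F) y).
    by apply: derivableP; apply: diff_derivable; exact: patch_differentiable2.
  apply: is_derive_val_eq (is_derive_edot dy (is_derive_cst z0 y w)) _.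
  by rewrite edot0r addr0.
have D2 : twice_derivable_on U (fun y => edot (F y) z0).
  move=> y Uy v; split=> [|w]; first by have [] := d1 y v Uy.
  by have [] := d2 y v w Uy.
have test v : edot ('D_v F u) z0 = 0 /\ edot ('D_v ('D_v F) u) z0 <= 0.
  have := derive_local_max v oU Uu D2 hmax.
  by have [_ ->] := d1 u v Uu; have [_ ->] := d2 u v v Uu.
have [_ _ ppu _] := patch_constant Uu.
have r2 : r ^+ 2 != 0 by rewrite expf_neq0 // gt_eqF.
have nuE : nu u = (p u / r ^+ 2) *: row_mx (lsubmx (F u)) 0.
  by rewrite patch_normal // scalerA mulrAC -expr2 ppu mulfV // scale1r.
set x := lsubmx (F u) in nuE; pose y := rsubmx (F u).
have [al [a z0E]] : exists al a, z0 = row_mx (al *: x) (a *: y).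
  have := patch_decomposition Uu z0.
  set D := 'D_(_) F u; set a := _^-1 * _ => E.
  have D0 : D = 0.
    apply/eqP; rewrite -edot_eq0.
    have := congr1 (edot D) E; rewrite !edotDr !edotZr (test _).1.
    rewrite [edot D (nu u)]edotC nu_tan // patch_tangent_radial //.
    by rewrite !mulr0 !addr0 => <-.
  exists (edot z0 (nu u) * (p u / r ^+ 2)), a.
  rewrite {1}E D0 add0r {2}nuE scalerA !scale_row_mx add_row_mx.
  by rewrite !scaler0 add0r addr0.
have y0 : 0 < edot y y := patch_radius_gt0 Uu.
have xr : edot x x = r ^+ 2 := phir Uu.
have yr : edot y y = cyl_radius R k ^+ 2.
  by have [_ Fy] := cylF Uu; rewrite -Fy enorm_sqr.
have al2 : al ^+ 2 = 1.
  apply: (mulIf r2); rewrite mul1r -{2}z0x z0E row_mxKl edotZl edotZr xr.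
  by rewrite expr2 mulrA.
have a2 : a ^+ 2 = 1.
  apply: (mulIf (lt0r_neq0 y0)); rewrite mul1r {2}yr -z0y z0E row_mxKr.
  by rewrite edotZl edotZr expr2 mulrA.
have second v : - (al * edot (lsubmx ('D_v F u)) (lsubmx ('D_v F u))) -
    a * edot (rsubmx ('D_v F u)) (rsubmx ('D_v F u)) <= 0.
  have := (test v).2; rewrite z0E edot_lrsubmx row_mxKl row_mxKr !edotZr.
  rewrite !(edotC _ x) !(edotC _ y) patch_horizontal_derivatives //.
  by rewrite (patch_radial_derivatives v Uu).2 !mulrN.
have one (b : R) (m : nat) (e : 'rV[R]_m) : b ^+ 2 = 1 -> e != 0 ->
    - (b * edot e e) <= 0 -> b = 1.
  rewrite -edot_gt0 => b2 e0; rewrite oppr_le0 pmulr_lge0 // => b0.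
  by apply/eqP; rewrite -(@eqrXn2 _ 2) // b2 expr1n.
have al1 : al = 1.
  have [e e0 xe] := exists_orthogonal x m2.
  have De : 'D_(row_mx e 0 *m frame_mx F u) F u = row_mx e 0.
    apply: patch_tangent_vector => //.
      rewrite nuE edotZr edot_lrsubmx !row_mxKl !row_mxKr.
      by rewrite (edotC e) xe edot0l addr0 mulr0.
    by rewrite edot_radial row_mxKr edot0l.
  apply: one al2 e0 _; have := second (row_mx e 0 *m frame_mx F u).
  by rewrite De row_mxKl row_mxKr edot0l mulr0 subr0.
have a1 : a = 1.
  have [e e0 ye] := exists_orthogonal y (ltnW hk2 : (2 <= k.+1)%N).
  have De : 'D_(row_mx 0 e *m frame_mx F u) F u = row_mx 0 e.
    apply: patch_tangent_vector => //.
      by rewrite nuE edotZr edot_lrsubmx !row_mxKl !row_mxKr edot0l edot0r addr0 mulr0.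
    by rewrite edot_radial row_mxKr edotC.
  apply: one a2 e0 _; have := second (row_mx 0 e *m frame_mx F u).
  by rewrite De row_mxKl row_mxKr edot0l mulr0 oppr0 add0r.
by rewrite z0E al1 a1 !scale1r hsubmxK.
Qed.

End Constant.
End Inside.

Section Outside.
Variable r : R.
Hypotheses (r0 : 0 < r) (hr : r ^+ 2 = 2 * `|h| * r + 2 * (n.+1 - k)%:R).

(** At a minimum of [phi] the horizontal part of [F u] is normal to the
    hypersurface, so [s2 u = 1] and [p u ^+ 2 = phi u]; as [r <= |p u|] and
    [r - 2 |h| >= 0], the Laplacian is then at most [- 2]. *)
Lemma patch_no_local_min u : U u -> r ^+ 2 <= phi u ->
  (\forall y \near u, phi u <= phi y) -> False.
Proof.
move=> Uu phir pmin.
have [d0 L0] := sum_squares_local_min (frame F u) (drift F u) oU Uu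
  twice_derivable_horizontal_sqr pmin.
have phi0 : 0 < phi u by apply: lt_le_trans phir; rewrite exprn_gt0.
have pphi : p u ^+ 2 = phi u.
  have := patch_decomposition Uu (horizontal (F u)).
  move=> /(congr1 (edot (horizontal (F u)))).
  rewrite !edotDr !edotZr -!edot_horizontal.
  have -> : edot (lsubmx (F u)) (lsubmx (radial u)) = 0 by rewrite row_mxKl edot0r.
  have := d0 (horizontal (F u) *m frame_mx F u).
  have [_ ->] := is_derive_horizontal_sqr (horizontal (F u) *m frame_mx F u) Uu.
  move=> /eqP; rewrite mulf_eq0 pnatr_eq0 /= => /eqP ->.
  by rewrite !row_mxKl mulr0 addr0 add0r -expr2 => <-.
have s1 : s2 u = 1.
  apply/eqP; rewrite eq_le s2_le1 //= -(ler_pM2l phi0) mulr1 -{1}pphi.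
  exact: p_sqr.
have pr : r <= `|p u|.
  by apply: le_norm_of_sqr; [exact: ltW|rewrite pphi].
move: L0; rewrite -/(lap u) patch_laplacian // s1.
have : - (h * p u) <= `|h| * `|p u| by rewrite -normrM -normrN ler_norm.
have : p u ^+ 2 = `|p u| ^+ 2 by rewrite real_normK ?num_real.
have h0 := normr_ge0 h.
have rh : 2 * `|h| <= r.
  rewrite -(ler_pM2r r0) -expr2 hr lerDl mulr_ge0 // ler0n.
have : r * (r - 2 * `|h|) <= `|p u| * (`|p u| - 2 * `|h|).
  by apply: ler_pM; move: r0 rh pr; lra.
by move: hr; lra.
Qed.

End Outside.
End Patch.

(** * Global argument *)

(** The two radii are the positive roots of [r ^+ 2 + 2 |h| r = c] and
    [r ^+ 2 - 2 |h| r = c]. *)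
Section Radii.
Variables (R : realType) (h c : R).
Hypothesis c0 : 0 < c.

Let s := Num.sqrt (h ^+ 2 + c).

Let s_sqr : s ^+ 2 = `|h| ^+ 2 + c.
Proof. by rewrite sqr_sqrtr ?real_normK ?num_real // addr_ge0 ?sqr_ge0 // ltW. Qed.

Lemma inner_radius : 0 < - `|h| + s /\
  (- `|h| + s) ^+ 2 + 2 * `|h| * (- `|h| + s) = c.
Proof.
split; last by rewrite -[RHS](addKr (`|h| ^+ 2)) -s_sqr; ring.
by rewrite addrC subr_gt0 -ltr_sqr ?nnegrE ?sqrtr_ge0 //= s_sqr ltrDl.
Qed.

Lemma outer_radius : 0 < `|h| + s /\
  (`|h| + s) ^+ 2 = 2 * `|h| * (`|h| + s) + c.
Proof.
split; last by rewrite -[X in _ = _ + X](addKr (`|h| ^+ 2)) -s_sqr; ring.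
by rewrite ltr_wpDl // sqrtr_gt0 ltr_wpDl // sqr_ge0.
Qed.

End Radii.

Section Tube.
Variables (R : realType) (n k : nat).

Definition tube (d : R) : set (ambient R n k) :=
  [set z | cylinder z /\ edot (lsubmx z) (lsubmx z) <= d].

Lemma tube_compact d : compact (tube d).
Proof.
apply: subclosed_compact (@compact_euclidean_ball R _ (0 : ambient R n k)
  (d + cyl_radius R k ^+ 2)) _; last first.
  move=> z [[_ zr] zd] /=; rewrite subr0 edot_lrsubmx lerD //.
  by rewrite -zr enorm_sqr.
pose xx (z : ambient R n k) := edot (lsubmx z) (lsubmx z).
pose yy (z : ambient R n k) := edot (rsubmx z) (rsubmx z).
have cl z : {for z, continuous xx} by apply: cont_edot; exact: continuous_lsubmx.
have cr z : {for z, continuous yy} by apply: cont_edot; exact: continuous_rsubmx.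
have -> : tube d = (setT `&` xx @^-1` [set x | x <= d]) `&`
    yy @^-1` [set x | x = cyl_radius R k ^+ 2].
  apply/seteqP; split=> [z [[_ zr] zd]|z [[_ zd] /= zr]].
    by split => //=; rewrite -zr enorm_sqr.
  split => //; split => //; rewrite /esphere /= /enorm -/(yy z) zr sqrtr_sqr.
  by rewrite ger0_norm // sqrtr_ge0.
have clx : closed (setT `&` xx @^-1` [set x | x <= d]).
  by apply: (closed_fiber (U := setT)).
by apply: (closed_fiber (U := setT)).
Qed.

End Tube.

Section Hypersurface.
Variables (R : realType) (n k : nat) (M : manifold R n).
Variables (X N : M -> ambient R n k) (h : R).
Hypotheses (hk2 : (2 <= k)%N) (hkn : (k < n)%N).
Hypotheses (hX : immersed_hypersurface X) (hN : unit_normal X N).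
Hypotheses (hproper : proper_in_cylinder X) (hcwmc : cwmc X N h).

Let hk : (k <= n)%N := ltnW hkn.

Lemma chart_patch c : manifold_atlas c ->
  cylinder_patch (chart_dom c) (X \o chart_par c) (N \o chart_par c).
Proof.
move=> Mc; have [Xcyl [smX immX]] := hX; have [_ N1 Np Nt] := hN.
split=> [|||||u _|u Uu v] //.
- exact: chart_dom_open.
- exact: smX.
- by move=> u _; exact: Xcyl.
- exact: immX.
- by move=> u _; exact: N1.
- exact: Np.
- exact: Nt.
Qed.

Let chart_cwmc c : manifold_atlas c -> forall u, chart_dom c u ->
  weighted_mean_curvature_vector (X \o chart_par c) ((N \o chart_par c) u) u =
    - h *: (N \o chart_par c) u.
Proof. exact: hcwmc. Qed.

Lemma chart_at p : exists (c : chart R n M) u,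
  [/\ manifold_atlas c, chart_dom c u & chart_par c u = p].
Proof.
have [c Mc cp] := (manifold_smooth M).1 p.
exists c, (chart_coord c p); split => //; first exact: chart_coord_dom.
exact: chart_coordK.
Qed.

Lemma near_chart_par (c : chart R n M) u (P : set M) :
  manifold_atlas c -> chart_dom c u ->
  (\forall q \near chart_par c u, P q) -> \forall y \near u, P (chart_par c y).
Proof. by move=> Mc Uu; exact: (chart_par_cont Uu). Qed.

Lemma near_chart_coord (c : chart R n M) u (P : set M) :
  manifold_atlas c -> chart_dom c u ->
  (\forall y \near u, P (chart_par c y)) -> \forall q \near chart_par c u, P q.
Proof.
move=> Mc Uu nP; have ci := chart_par_img Uu.
have n1 : \forall q \near chart_par c u, chart_img c q.
  by apply: open_nbhs_nbhs; split => //; exact: chart_img_open.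
have n2 : \forall q \near chart_par c u, P (chart_par c (chart_coord c q)).
  have nP' : nbhs (chart_coord c (chart_par c u)) (fun y => P (chart_par c y)).
    by rewrite chart_parK.
  exact: chart_coord_cont ci _ nP'.
by apply: filterS2 n1 n2 => q iq; rewrite chart_coordK.
Qed.

Lemma immersion_continuous p : {for p, continuous X}.
Proof.
have [c [u [Mc Uu <-]]] := chart_at p.
have cF : {for u, continuous (X \o chart_par c)}.
  apply: differentiable_continuous.
  exact: patch_differentiable (chart_patch Mc) _ Uu.
move=> A nA; have nA' : nbhs u ((X \o chart_par c) @^-1` A) := cF _ nA.
exact: (near_chart_coord (P := X @^-1` A) Mc Uu nA').
Qed.

Definition axis_sqr (p : M) : R := edot (lsubmx (X p)) (lsubmx (X p)).

Lemma axis_sqr_continuous p : {for p, continuous axis_sqr}.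
Proof.
have cl : {for p, continuous (fun q => lsubmx (X q))}.
  by apply: continuous_comp (@immersion_continuous p) _; exact: continuous_lsubmx.
exact: cont_edot.
Qed.

Lemma axis_sqr_compact d : compact [set p | axis_sqr p <= d].
Proof.
have -> : [set p | axis_sqr p <= d] = X @^-1` (@tube R n k d).
  by apply/seteqP; split=> [p pd|p [_ pd]] //; split => //; exact: (hX.1 p).
by apply: hproper; [move=> z []|exact: tube_compact].
Qed.

(** ** Hypersurfaces outside a tube *)

Lemma not_outside r : 0 < r -> r ^+ 2 = 2 * `|h| * r + 2 * (n.+1 - k)%:R ->
  ~ (forall p, r ^+ 2 <= axis_sqr p).
Proof.
move=> r0 hr out; have [p0 _] := manifold_nonempty M.
have [||p pK pmin] := @compact_EVT_min _ R axis_sqr _ _ (@axis_sqr_compact (axis_sqr p0)).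
- by exists p0 => /=.
- by apply: continuous_subspaceT => q; exact: axis_sqr_continuous.
rewrite inE /= in pK.
have {}pmin q : axis_sqr p <= axis_sqr q.
  have [qp0|/ltW p0q] := leP (axis_sqr q) (axis_sqr p0); last exact: le_trans p0q.
  by apply: pmin; rewrite inE.
have [c [u [Mc Uu cup]]] := chart_at p.
apply: (patch_no_local_min hk hk2 (chart_patch Mc) (chart_cwmc Mc) r0 hr Uu).
  exact: out.
apply: (near_chart_par (P := fun q => axis_sqr (chart_par c u) <= axis_sqr q) Mc Uu).
by apply: nearW => q; rewrite cup; exact: pmin.
Qed.

(** ** Hypersurfaces inside a tube *)

Section Inside.
Variable r : R.
Hypotheses (r0 : 0 < r) (hr : r ^+ 2 + 2 * `|h| * r = 2 * (n - k)%:R).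
Hypothesis inside : forall p, axis_sqr p <= r ^+ 2.

Lemma inside_compact : compact [set: M].
Proof.
suff <- : [set p | axis_sqr p <= r ^+ 2] = [set: M] by exact: axis_sqr_compact.
by apply/seteqP; split=> // p _; exact: inside.
Qed.

(** The set where the maximal value [r ^+ 2] is attained is open by the strong
    maximum principle; on its complement, which is therefore compact, a maximum
    of [axis_sqr] would be a local maximum, hence have the value [r ^+ 2]. This
    handles all components at once. *)
Lemma inside_constant p : axis_sqr p = r ^+ 2.
Proof.
apply: contrapT => pr.
pose B := [set q | axis_sqr q <> r ^+ 2].
have clB : closed B.
  rewrite -[B]setCK; apply: open_closedC; rewrite openE => q /= /contrapT qr.
  have [c [u [Mc Uu cuq]]] := chart_at q.
  have := patch_strong_maximum hk hk2 (chart_patch Mc) (chart_cwmc Mc) r0 hr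
    (fun y _ => inside (chart_par c y)) Uu.
  rewrite {1}/horizontal_sqr /= cuq => /(_ qr) nr.
  rewrite /interior /= -cuq.
  apply: (near_chart_coord (P := ~` B) Mc Uu).
  by apply: filterS nr => y yr; apply.
have cB : compact B by apply: subclosed_compact clB inside_compact _.
have [||q qB qmax] := @compact_EVT_max _ R axis_sqr _ _ cB.
- by exists p.
- by apply: continuous_subspaceT => q; exact: axis_sqr_continuous.
rewrite inE in qB; apply: (qB).
have [c [u [Mc Uu cuq]]] := chart_at q.
have nB : \forall y \near q, B y.
  have : axis_sqr q < r ^+ 2 by rewrite lt_neqAle inside andbT; exact/eqP.
  move=> /(near_lt_continuous (@axis_sqr_continuous q)).
  by apply: filterS => y yr /eqP; rewrite lt_eqF.
have nmax : \forall y \near u, axis_sqr (chart_par c y) <= axis_sqr (chart_par c u).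
  apply: (near_chart_par (P := fun y => axis_sqr y <= axis_sqr (chart_par c u)) Mc Uu).
  by rewrite cuq; apply: filterS nB => y By; apply: qmax; rewrite inE.
have [_ + _ _] := patch_local_max hk hk2 (chart_patch Mc) (chart_cwmc Mc) r0 hr
  Uu (inside _) nmax.
by rewrite /horizontal_sqr /= cuq.
Qed.

Let chart_constant (c : chart R n M) u : chart_dom c u ->
  horizontal_sqr (X \o chart_par c) u = r ^+ 2.
Proof. by move=> _; exact: inside_constant. Qed.

(** Every [z] of the product is reached where [edot (X p) z] is maximal. *)
Lemma inside_range :
  range X = rowprod (@esphere R (n.+1 - k) r) (@esphere R k.+1 (cyl_radius R k)).
Proof.
apply/seteqP; split=> [_ [p _ <-]|z [zx zy]].
  split; last exact: (hX.1 p).2.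
  by rewrite /esphere /= /enorm -/(axis_sqr p) inside_constant sqrtr_sqr gtr0_norm.
have [||p _ pmax] := @compact_EVT_max _ R (fun p => edot (X p) z) _ _ inside_compact.
- exact: manifold_nonempty.
- apply: continuous_subspaceT => q.
  by apply: cont_edot; [exact: immersion_continuous|exact: cvg_cst].
exists p => //; have [c [u [Mc Uu cup]]] := chart_at p.
have m2 : (2 <= n.+1 - k)%N by rewrite ltn_subRL addn1 ltnS.
rewrite -cup.
apply: (patch_height_max hk hk2 (chart_patch Mc) (chart_cwmc Mc) r0 hr
  (@chart_constant c) m2 _ _ Uu).
- by rewrite -enorm_sqr zx.
- by rewrite -enorm_sqr zy.
- apply: (near_chart_par
    (P := fun q => edot (X q) z <= edot (X (chart_par c u)) z) Mc Uu).
  by apply: nearW => q; rewrite cup; apply: pmax; rewrite inE.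
Qed.

Lemma outward_normal_inside p :
  outward_normal (X p) = row_mx (r^-1 *: lsubmx (X p)) 0.
Proof.
have x0 : lsubmx (X p) != 0.
  by rewrite -edot_gt0 -/(axis_sqr p) inside_constant exprn_gt0.
rewrite outward_normalE // /enorm -/(axis_sqr p) inside_constant sqrtr_sqr.
by rewrite gtr0_norm // scale_row_mx scaler0.
Qed.

Lemma inside_outward_unit_normal : unit_normal X (@outward_normal R n k \o X).
Proof.
split.
- move=> c Mc m.
  pose A : 'M[R]_(n.+1 - k + k.+1) := block_mx (r^-1)%:M 0 0 0.
  have cA : continuous (mulmxr A : 'rV_(n.+1 - k + k.+1) -> 'rV_(n.+1 - k + k.+1)).
    move=> z; apply: cont_mx => i j.
    under [X in {for _, continuous X}]eq_fun do rewrite /= mxE.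
    apply: cont_sum => l; apply: cont_mul; last exact: cont_cst.
    by apply: cont_coord => ?.
  have := Ck_on_linear (chart_dom_open (c := c)) cA (hX.2.1 c Mc m).
  apply: Ck_on_eq; first exact: chart_dom_open.
  move=> u Uu /=; rewrite outward_normal_inside.
  rewrite -{1}[X _]hsubmxK mul_row_block !mulmx0 !addr0 mul_mx_scalar.
  by [].
- move=> p; rewrite /= outward_normal_inside.
  rewrite /enorm edot_lrsubmx row_mxKl row_mxKr edot0l addr0 edotZl edotZr.
  rewrite -/(axis_sqr p) inside_constant mulrA -expr2 -exprMn.
  by rewrite mulVf ?gt_eqF // expr1n sqrtr1.
- by move=> p; rewrite /= outward_normal_inside cyl_proj_horizontal.
- move=> c Mc u Uu v.
  have := patch_outward hk hk2 (chart_patch Mc) (chart_cwmc Mc) r0 hr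
    (@chart_constant c) Uu.
  have [_ _ _ Nt] := hN.
  by rewrite /= => ->; rewrite edotZl (Nt c Mc u Uu) mulr0.
Qed.

Lemma inside_outward_cwmc : cwmc X (@outward_normal R n k \o X) `|h|.
Proof.
move=> c Mc u Uu.
exact: (patch_outward_curvature hk hk2 (chart_patch Mc) (chart_cwmc Mc) r0 hr
  (@chart_constant c) Uu).
Qed.

End Inside.
End Hypersurface.

Theorem corollary2 (R : realType) (n k : nat)
    (hn : (3 <= n)%N) (hk2 : (2 <= k)%N) (hkn : (k <= n - 1)%N)
    (M : manifold R n) (X N : M -> ambient R n k) (h : R)
    (hX : immersed_hypersurface X) (hN : unit_normal X N)
    (hcomplete : riem_complete X) (hproper : proper_in_cylinder X)
    (hcwmc : cwmc X N h) :
  (let r : R := - `|h| + Num.sqrt (h ^+ 2 + 2 * (n - k)%:R) in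
   range X `<=` rowprod (@ecball R (n.+1 - k) r)
                        (@esphere R k.+1 (cyl_radius R k)) ->
   [/\ range X = rowprod (@esphere R (n.+1 - k) r)
                         (@esphere R k.+1 (cyl_radius R k)),
       unit_normal X (@outward_normal R n k \o X) &
       exists2 h' : R, cwmc X (@outward_normal R n k \o X) h' & 0 <= h']) /\
  (let r : R := `|h| + Num.sqrt (h ^+ 2 + 2 * (n.+1 - k)%:R) in
   ~ (range X `<=` @cylinder R n k `\`
        rowprod (@eball R (n.+1 - k) r)
                (@esphere R k.+1 (cyl_radius R k)))).
Proof.
have kn : (k < n)%N.
  by apply: leq_ltn_trans hkn _; rewrite subn1 prednK // (ltn_trans _ hn).
split=> r.
- have [r0 hr] : 0 < r /\ r ^+ 2 + 2 * `|h| * r = 2 * (n - k)%:R.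
    by apply: inner_radius; rewrite mulr_gt0 // ltr0n subn_gt0.
  move=> sub; have inside p : axis_sqr X p <= r ^+ 2.
    have [pr _] := sub _ (imageP X (I : [set: M] p)).
    by rewrite /axis_sqr -enorm_sqr ler_sqr ?nnegrE ?sqrtr_ge0 //= ltW.
  split.
  + exact: inside_range hk2 kn hX hN hproper hcwmc _ r0 hr inside.
  + exact: inside_outward_unit_normal hk2 kn hX hN hproper hcwmc _ r0 hr inside.
  + exists `|h| => //.
    exact: inside_outward_cwmc hk2 kn hX hN hproper hcwmc _ r0 hr inside.
- have [r0 hr] : 0 < r /\ r ^+ 2 = 2 * `|h| * r + 2 * (n.+1 - k)%:R.
    by apply: outer_radius; rewrite mulr_gt0 // ltr0n subn_gt0 ltnW.
  move=> sub; apply: (not_outside hk2 kn hX hN hproper hcwmc r0 hr) => p.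
  have [pcyl pout] := sub _ (imageP X (I : [set: M] p)).
  have pr : r <= enorm (lsubmx (X p)).
    by rewrite leNgt; apply/negP => pr; apply: pout; split => //; exact: pcyl.2.
  by rewrite /axis_sqr -enorm_sqr ler_sqr ?nnegrE ?sqrtr_ge0 //= ltW.
Qed.
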